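(* Let a nonlocal solid occupy $\mathcal{B}_t\subset\mathbb{R}^3$ at time $t$, with mass density $\rho$, displacement $\mathbf{u}$, body force per unit mass $\mathbf{b}$, and nonlocal stress tensor $\tilde{\bm{\sigma}}$, all fields being sufficiently regular. Assume conservation of mass, and assume that for every part of the solid, occupying the domain $\mathcal{D}_t\subseteq\mathcal{B}_t$ with outward unit normal $\bm{n}$ on $\partial\mathcal{D}_t$, the balance of linear momentum $$\frac{\mathrm{d}}{\mathrm{d}t}\int_{\mathcal{D}_t}\rho\,\dot{\mathbf{u}}\,\mathrm{d}V=\int_{\mathcal{D}_t}\rho\,\mathbf{b}\,\mathrm{d}V+\int_{\partial\mathcal{D}_t}\tilde{\mathbf{t}}(\bm{x},t,\bm{n})\,\mathrm{d}A$$ holds, where the surface traction $\tilde{\mathbf{t}}$ is the nonlocal traction with components $\tilde t_j(\bm{x},t,\bm{n})=\sum_{i=1}^3 n_i\, I^{1-\alpha}_{x_i}\tilde{\sigma}_{ij}(\bm{x},t)$. Then $$\rho(\bm{x},t)\,\ddot{u}_j(\bm{x},t)=\rho(\bm{x},t)\,b_j(\bm{x},t)+\sum_{i=1}^3\mathfrak{D}^{\alpha}_{x_i}\tilde{\sigma}_{ij}(\bm{x},t),\qquad j=1,2,3,\quad\forall\,\bm{x}\in\mathcal{B}_t .$$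
   Context: Here $\alpha\in(0,1)$, $\dot{\mathbf{u}}$ is the velocity of the material particle and $\ddot{\mathbf{u}}$ its acceleration (material time derivative of the velocity); $\mathcal{D}_t$ is a material domain, i.e. the image at time $t$, under the motion, of a fixed part of the solid. Coordinates are Cartesian. Riesz-type fractional integral in direction $x_i$, with length scales $l_{A_i},l_{B_i}>0$ (so that the intervals involved lie in the solid): $$I^{1-\alpha}_{x_i}\chi=\tfrac12\Gamma(2-\alpha)\left[l_{B_i}^{\alpha-1}\left({}_{x_i-l_{B_i}}I^{1-\alpha}_{x_i}\chi\right)+l_{A_i}^{\alpha-1}\left({}_{x_i}I^{1-\alpha}_{x_i+l_{A_i}}\chi\right)\right],$$ where ${}_{a}I^{1-\alpha}_{x}\chi=\frac{1}{\Gamma(1-\alpha)}\int_a^x (x-s)^{-\alpha}\chi(s)\,\mathrm{d}s$ and ${}_{x}I^{1-\alpha}_{b}\chi=\frac{1}{\Gamma(1-\alpha)}\int_x^b (s-x)^{-\alpha}\chi(s)\,\mathrm{d}s$ are the left and right fractional integrals (acting in the $i$-th coordinate). Riesz Riemann-Liouville derivative of order $\alpha$: $$\mathfrak{D}^{\alpha}_{x_i}\chi=\tfrac12\Gamma(2-\alpha)\left[l_{B_i}^{\alpha-1}\left({}^{RL}_{x_i-l_{B_i}}D^{\alpha}_{x_i}\chi\right)-l_{A_i}^{\alpha-1}\left({}^{RL}_{x_i}D^{\alpha}_{x_i+l_{A_i}}\chi\right)\right],$$ with ${}^{RL}D^{\alpha}$ the left/right Riemann-Liouville derivatives, i.e.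 $\frac{\mathrm{d}}{\mathrm{d}x_i}$, respectively $-\frac{\mathrm{d}}{\mathrm{d}x_i}$, of the corresponding left/right fractional integrals of order $1-\alpha$ above; it is understood in the sense $\mathfrak{D}^{\alpha}_{x_i}\chi=\frac{\mathrm{d}}{\mathrm{d}x_i}\left[I^{1-\alpha}_{x_i}\chi\right]$. *)

(* Defs.v *)
From HB Require Import structures.
From mathcomp Require Import all_boot all_order all_algebra.
From mathcomp Require Import all_classical all_reals all_analysis.
Set Implicit Arguments.
Unset Strict Implicit.
Unset Printing Implicit Defensive.
Import Order.TTheory GRing.Theory Num.Theory.
Import numFieldNormedType.Exports.
Local Open Scope classical_set_scope.
Local Open Scope ring_scope.

(** Euclidean geometry of R^3.  The topology of ['rV[R]_3] is that of the sup
    norm; lengths and areas use the Euclidean norm [enorm]. *)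

Definition enorm (R : realType) (v : 'rV[R]_3) : R :=
  Num.sqrt (\sum_i v 0 i ^+ 2).

(* Indices are added modulo 3. *)
Definition cross (R : realType) (v w : 'rV[R]_3) : 'rV[R]_3 :=
  \row_(k < 3) (v 0 (k + 1) * w 0 (k + 2%:R) - v 0 (k + 2%:R) * w 0 (k + 1)).

Definition frontier (T : topologicalType) (D : set T) : set T :=
  closure D `\` interior D.

(** Volume integrals.  Measures live on [R * R * R], so sets and functions on
    ['rV[R]_3] are pulled back along the identification [vec3]. *)

Definition vec3 (R : realType) (p : R * R * R) : 'rV[R]_3 :=
  \row_(k < 3) nth 0 [:: p.1.1; p.1.2; p.2] k.

Definition borel3 (R : realType) (D : set 'rV[R]_3) : Prop :=
  measurable (@vec3 R @^-1` D : set (measurableTypeR R * measurableTypeR R *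
                                     measurableTypeR R)).

Definition volume_integral (R : realType) (D : set 'rV[R]_3)
    (f : 'rV[R]_3 -> R) : R :=
  \int[((lebesgue_measure \x lebesgue_measure) \x lebesgue_measure)%E]_(p in
    @vec3 R @^-1` D) f (vec3 p).

(** Surface integrals over piecewise C^1 surfaces: a surface is a finite family
    of patches parametrized by the unit square. *)

Definition square (R : realType) : set (R * R) := `[0, 1] `*` `[0, 1].

Definition open_square (R : realType) : set (R * R) := `]0, 1[ `*` `]0, 1[.

Definition tangent1 (R : realType) (r : R * R -> 'rV[R]_3) (p : R * R) :
  'rV[R]_3 := derive1 (fun s => r (s, p.2)) p.1.

Definition tangent2 (R : realType) (r : R * R -> 'rV[R]_3) (p : R * R) :
  'rV[R]_3 := derive1 (fun s => r (p.1, s)) p.2.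

Definition C1_patch (R : realType) (r : R * R -> 'rV[R]_3) : Prop :=
  exists O : set (R * R), [/\ open O, @square R `<=` O,
    forall p, O p -> derivable (fun s => r (s, p.2)) p.1 1
                  /\ derivable (fun s => r (p.1, s)) p.2 1,
    {within O, continuous (tangent1 r)} &
    {within O, continuous (tangent2 r)}].

Definition area_vector (R : realType) (r : R * R -> 'rV[R]_3) (p : R * R) :
  'rV[R]_3 := cross (tangent1 r p) (tangent2 r p).

Definition unit_normal (R : realType) (r : R * R -> 'rV[R]_3) (p : R * R) :
  'rV[R]_3 := (enorm (area_vector r p))^-1 *: area_vector r p.

(* Seen from the point [x], the direction [n] points out of [D]. *)
Definition outward (R : realType) (D : set 'rV[R]_3) (x n : 'rV[R]_3) : Prop :=
  exists2 e : R, 0 < e &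
    forall s, 0 < s < e -> ~ D (x + s *: n) /\ D (x - s *: n).

(* The patches [r k] cover the boundary of [D]; they may meet only along their
   edges, where degeneracies (as at the poles of a sphere) are allowed too. *)
Definition piecewise_C1_boundary (R : realType) (D : set 'rV[R]_3) (m : nat)
    (r : 'I_m -> R * R -> 'rV[R]_3) : Prop :=
  [/\ forall k, C1_patch (r k),
      frontier D = \bigcup_k (r k @` @square R),
      forall k l p q, open_square p -> open_square q ->
        r k p = r l q -> k = l /\ p = q,
      forall k p, open_square p -> area_vector (r k) p != 0 &
      forall k p, open_square p -> outward D (r k p) (unit_normal (r k) p)].

(* The integral of [f x n], with [n] the unit normal at [x]. *)
Definition surface_integral (R : realType) (m : nat)
    (r : 'I_m -> R * R -> 'rV[R]_3) (f : 'rV[R]_3 -> 'rV[R]_3 -> R) : R :=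
  \sum_(k < m) \int[(lebesgue_measure \x lebesgue_measure)%E]_(p in @square R)
    (f (r k p) (unit_normal (r k) p) * enorm (area_vector (r k) p)).

(** Fractional integrals and derivatives. *)

Definition Gamma (R : realType) (z : R) : R :=
  \int[lebesgue_measure]_(s in `]0, +oo[) (s `^ (z - 1) * expR (- s)).

Definition left_fracI (R : realType) (beta a x : R) (f : R -> R) : R :=
  (Gamma beta)^-1 *
  \int[lebesgue_measure]_(s in `[a, x]) ((x - s) `^ (beta - 1) * f s).

Definition right_fracI (R : realType) (beta x b : R) (f : R -> R) : R :=
  (Gamma beta)^-1 *
  \int[lebesgue_measure]_(s in `[x, b]) ((s - x) `^ (beta - 1) * f s).

(* [x] with its [i]-th coordinate replaced by [s] *)
Definition set_coord (R : realType) (x : 'rV[R]_3) (i : 'I_3) (s : R) :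
  'rV[R]_3 := \row_(k < 3) (if k == i then s else x 0 k).

(* The left and right fractional integrals of [chi] along the [i]-th axis, over
   the interval reaching [lB x 0 i] below and [lA x 0 i] above [x 0 i].  The
   length scales are functions of the point, as they cannot be constant when
   these intervals have to remain inside a bounded solid. *)
Definition left_fracI_along (R : realType) (beta : R)
    (lB : 'rV[R]_3 -> 'rV[R]_3) (i : 'I_3) (chi : 'rV[R]_3 -> R)
    (x : 'rV[R]_3) : R :=
  left_fracI beta (x 0 i - lB x 0 i) (x 0 i) (fun s => chi (set_coord x i s)).

Definition right_fracI_along (R : realType) (beta : R)
    (lA : 'rV[R]_3 -> 'rV[R]_3) (i : 'I_3) (chi : 'rV[R]_3 -> R)
    (x : 'rV[R]_3) : R :=
  right_fracI beta (x 0 i) (x 0 i + lA x 0 i) (fun s => chi (set_coord x i s)).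

(* The Riesz-type fractional integral of order [1 - alpha]. *)
Definition riesz_I (R : realType) (alpha : R) (lA lB : 'rV[R]_3 -> 'rV[R]_3)
    (i : 'I_3) (chi : 'rV[R]_3 -> R) (x : 'rV[R]_3) : R :=
  2^-1 * Gamma (2 - alpha) *
  (lB x 0 i `^ (alpha - 1) * left_fracI_along (1 - alpha) lB i chi x +
   lA x 0 i `^ (alpha - 1) * right_fracI_along (1 - alpha) lA i chi x).

(* The Riesz Riemann-Liouville derivative of order [alpha]: the total derivative
   in the [i]-th coordinate, the terminals of the integrals moving with [x].
   See [riesz_DE] for its splitting into one-sided derivatives. *)
Definition riesz_D (R : realType) (alpha : R) (lA lB : 'rV[R]_3 -> 'rV[R]_3)
    (i : 'I_3) (chi : 'rV[R]_3 -> R) (x : 'rV[R]_3) : R :=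
  'D_(delta_mx 0 i) (riesz_I alpha lA lB i chi) x.

Definition left_RL (R : realType) (alpha : R) (lB : 'rV[R]_3 -> 'rV[R]_3)
    (i : 'I_3) (chi : 'rV[R]_3 -> R) (x : 'rV[R]_3) : R :=
  'D_(delta_mx 0 i) (left_fracI_along (1 - alpha) lB i chi) x.

Definition right_RL (R : realType) (alpha : R) (lA : 'rV[R]_3 -> 'rV[R]_3)
    (i : 'I_3) (chi : 'rV[R]_3 -> R) (x : 'rV[R]_3) : R :=
  - 'D_(delta_mx 0 i) (right_fracI_along (1 - alpha) lA i chi) x.

Lemma riesz_DE (R : realType) (alpha : R) (cA cB : 'rV[R]_3) (i : 'I_3)
    (chi : 'rV[R]_3 -> R) (x : 'rV[R]_3) :
  derivable (left_fracI_along (1 - alpha) (cst cB) i chi) x (delta_mx 0 i) ->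
  derivable (right_fracI_along (1 - alpha) (cst cA) i chi) x (delta_mx 0 i) ->
  riesz_D alpha (cst cA) (cst cB) i chi x =
  2^-1 * Gamma (2 - alpha) *
  (cB 0 i `^ (alpha - 1) * left_RL alpha (cst cB) i chi x -
   cA 0 i `^ (alpha - 1) * right_RL alpha (cst cA) i chi x).
Proof.
rewrite /riesz_D /left_RL /right_RL mulrN opprK.
have -> : riesz_I alpha (cst cA) (cst cB) i chi =
  (2^-1 * Gamma (2 - alpha)) \*: (
    (cB 0 i `^ (alpha - 1)) \*: left_fracI_along (1 - alpha) (cst cB) i chi +
    (cA 0 i `^ (alpha - 1)) \*: right_fracI_along (1 - alpha) (cst cA) i chi).
  by [].
move: (left_fracI_along _ _ _ _) (right_fracI_along _ _ _ _) => f g df dg.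
move: (_ `^ _) (_ `^ _) (_ * Gamma _) => c a k.
have daf := derivableZ (k := a) df; have dcg := derivableZ (k := c) dg.
by rewrite (deriveZ k (derivableD daf dcg)) (deriveD daf dcg) !deriveZ.
Qed.

(* Component [j] is the sum over [i] of [n_i] times the fractional integral of
   [sigma_ij] in direction [x_i]. *)
Definition nonlocal_traction (R : realType) (alpha : R)
    (lA lB : 'rV[R]_3 -> 'rV[R]_3) (sigma : 'rV[R]_3 -> 'M[R]_3)
    (x n : 'rV[R]_3) : 'rV[R]_3 :=
  \row_(j < 3) \sum_(i < 3)
    n 0 i * riesz_I alpha lA lB i (fun y => sigma y i j) x.

(** Kinematics.  [B0] is the reference configuration and [u t X] the
    displacement at time [t] of the particle with reference position [X]. *)

Definition motion (R : realType) (u : R -> 'rV[R]_3 -> 'rV[R]_3) (t : R)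
    (X : 'rV[R]_3) : 'rV[R]_3 := X + u t X.

Definition configuration (R : realType) (B0 : set 'rV[R]_3)
    (u : R -> 'rV[R]_3 -> 'rV[R]_3) (t : R) : set 'rV[R]_3 :=
  motion u t @` B0.

(* The particle of [B0] that is at [x] at time [t]. *)
Definition particle (R : realType) (B0 : set 'rV[R]_3)
    (u : R -> 'rV[R]_3 -> 'rV[R]_3) (t : R) : 'rV[R]_3 -> 'rV[R]_3 :=
  'pinv_(fun=> 0) B0 (motion u t).

Definition velocity (R : realType) (B0 : set 'rV[R]_3)
    (u : R -> 'rV[R]_3 -> 'rV[R]_3) (t : R) (x : 'rV[R]_3) : 'rV[R]_3 :=
  derive1 (fun s => u s (particle B0 u t x)) t.

(* The material time derivative of the velocity. *)
Definition acceleration (R : realType) (B0 : set 'rV[R]_3)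
    (u : R -> 'rV[R]_3 -> 'rV[R]_3) (t : R) (x : 'rV[R]_3) : 'rV[R]_3 :=
  derive1 (fun s => velocity B0 u s (motion u s (particle B0 u t x))) t.

(* During [J] the body [B0] moves homeomorphically through open regions, and
   the displacement is of class C^2 in time, jointly continuously in the
   particle. *)
Definition regular_motion (R : realType) (J : set R) (B0 : set 'rV[R]_3)
    (u : R -> 'rV[R]_3 -> 'rV[R]_3) : Prop :=
  [/\ open B0,
      forall t, J t -> [/\ {in B0 &, injective (motion u t)},
        open (configuration B0 u t) &
        {within configuration B0 u t, continuous (particle B0 u t)}],
      forall t X, J t -> B0 X -> derivable (u ^~ X) t 1
                              /\ derivable (derive1 (u ^~ X)) t 1 &
      [/\ {within J `*` B0, continuous (fun p => u p.1 p.2)},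
          {within J `*` B0, continuous (fun p => derive1 (u ^~ p.2) p.1)} &
          {within J `*` B0,
            continuous (fun p => derive1 (derive1 (u ^~ p.2)) p.1)}]].

(* The parts of the solid, in the reference configuration; at time [t] the part
   [P] occupies [motion u t @` P]. *)
Definition part (R : realType) (B0 P : set 'rV[R]_3) : Prop :=
  [/\ borel3 P, compact (closure P) & closure P `<=` B0].

Definition mass_conservation (R : realType) (J : set R) (B0 : set 'rV[R]_3)
    (u : R -> 'rV[R]_3 -> 'rV[R]_3) (rho : R -> 'rV[R]_3 -> R) : Prop :=
  forall P s t, part B0 P -> J s -> J t ->
    volume_integral (motion u s @` P) (rho s) =
    volume_integral (motion u t @` P) (rho t).

(* [traction t x n] is the surface traction. *)
Definition momentum_balance (R : realType) (J : set R) (B0 : set 'rV[R]_3)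
    (u : R -> 'rV[R]_3 -> 'rV[R]_3) (rho : R -> 'rV[R]_3 -> R)
    (b : R -> 'rV[R]_3 -> 'rV[R]_3)
    (traction : R -> 'rV[R]_3 -> 'rV[R]_3 -> 'rV[R]_3) : Prop :=
  forall P t (m : nat) (r : 'I_m -> R * R -> 'rV[R]_3) (j : 'I_3),
    part B0 P -> J t -> piecewise_C1_boundary (motion u t @` P) r ->
    is_derive t 1
      (fun s => volume_integral (motion u s @` P)
                  (fun x => rho s x * velocity B0 u s x 0 j))
      (volume_integral (motion u t @` P) (fun x => rho t x * b t x 0 j) +
       surface_integral r (fun x n => traction t x n 0 j)).

(* Main.v *)
From HB Require Import structures.
Require Import Defs.
From mathcomp Require Import all_boot all_order all_algebra.
From mathcomp Require Import all_classical all_reals all_analysis.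
From mathcomp Require Import measurable_realfun.
From mathcomp Require Import lra ring.
Set Implicit Arguments.
Unset Strict Implicit.
Unset Printing Implicit Defensive.
Import Order.TTheory GRing.Theory Num.Theory.
Import numFieldNormedType.Exports.
Local Open Scope classical_set_scope.
Local Open Scope ring_scope.

(** Localization of the integral balance on small cubes.  Around the point [x] at
    time [t], take a closed cube of half-side [e] as the place that a part of
    the solid occupies at time [t]; every field involved is continuous, hence
    within [eta] of its value at [x] on a small enough cube, and each of the
    three terms of the momentum balance is then estimated up to [eta] times the
    volume of the cube.

    - Rate of momentum ([momentum_rate_near]).  Conservation of mass for all
      parts says that the mass distribution, carried back to the reference
      configuration, does not change with time.  The momentum at time [s] is
      therefore the integral over the fixed cube, with the fixed density
      [rho t], of the velocity at time [s] of the particle that is at the given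
      point at time [t] ([mass_transport]).  The passage from masses of parts to
      integrals of functions is the layer-cake formula: an integral is
      determined by the masses of the level sets [s < h], and these are parts.
      The mean value theorem in time then bounds the difference quotients of the
      momentum by means of the acceleration, which is jointly continuous in
      time and particle; no differentiation under the integral sign occurs.

    - Surface forces ([cube_flux_near]).  The boundary of the cube consists of
      six affine patches, with outward normals plus or minus the coordinate
      axes, so the traction integral is a sum over the axes [i] of differences
      of [riesz_I] between opposite faces.  By the mean value theorem along the
      [i]-th axis, these differences are [2 * e] times values of [riesz_D] in
      the cube.

    - Body forces are a plain average ([Rintegral_near]).

    Dividing by the volume leaves the local balance at [x] up to a constant times
    [eta] ([localize_balance]), with [eta] arbitrary. *)

(** * Integrals determined by level sets, and averages *)

(** Tonelli, applied to the indicator of the region [0 <= s < h x] weighted by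
    [w]. *)
Lemma integral_layer_cake d (T : measurableType d) (R : realType)
    (mu : {sigma_finite_measure set T -> \bar R}) (K : set T) (w h : T -> R) :
  measurable K -> measurable_fun K w -> measurable_fun K h ->
  (forall x, K x -> 0 <= w x) -> (forall x, K x -> 0 <= h x) ->
  (\int[mu]_(x in K) (w x * h x)%:E =
   \int[@lebesgue_measure R]_(s in `[0%R, +oo[)
     \int[mu]_(x in K `&` [set x | (s < h x)%R]) (w x)%:E)%E.
Proof.
move=> mK mw mh w0 h0.
pose w' := w \_ K; pose h' := h \_ K.
have mw' : measurable_fun setT w' by apply/(measurable_restrictT _ mK).
have mh' : measurable_fun setT h' by apply/(measurable_restrictT _ mK).
have w'0 x : 0 <= w' x by rewrite /w' patchE; case: ifPn => // /set_mem/w0.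
pose A : set (T * measurableTypeR R) := [set z | 0 <= z.2 /\ z.2 < h' z.1].
have mA : measurable A.
  have -> : A = (snd @^-1` `[0, +oo[) `&` [set z | z.2 < h' z.1].
    by apply/seteqP; split=> [z|z] /=; rewrite in_itv/= andbT.
  apply: measurableI.
    rewrite -[X in measurable X]setTI.
    by apply: measurable_snd => //; exact: measurable_itv.
  rewrite -[X in measurable X]setTI.
  have mlt : measurable_fun setT
      (fun z : T * measurableTypeR R => z.2 < h' z.1).
    apply: measurable_fun_ltr; first exact: measurable_snd.
    exact: (measurableT_comp mh' measurable_fst).
  exact: (mlt measurableT [set true]).
pose F (z : T * measurableTypeR R) : \bar R := (w' z.1 * \1_A z)%:E.
have F0 z : (0 <= F z)%E by rewrite lee_fin mulr_ge0.
have mF : measurable_fun setT F.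
  apply/measurable_EFinP; apply: measurable_funM; last exact: measurable_indic.
  exact: (measurableT_comp mw' measurable_fst).
have := fubini_tonelli (m1 := mu) (m2 := @lebesgue_measure R) F mF F0.
move=> FT; transitivity (\int[mu]_x \int[@lebesgue_measure R]_s F (x, s))%E.
  rewrite integral_mkcond; apply: eq_integral => x _; rewrite /F /=.
  under eq_integral do rewrite EFinM.
  rewrite (_ : (fun s => _) =
      (fun s => (w' x)%:E * (\1_(`[0, h' x[ : set R) s)%:E)%E); last first.
    apply/funext => s; congr (_ * EFin _)%E; rewrite !indicE.
    congr (nat_of_bool _)%:R; apply/idP/idP; rewrite /A !inE/= in_itv/=.
      by move=> [-> ->].
    by move=> /andP.
  have mI : measurable_fun (setT : set (measurableTypeR R))
      (EFin \o (\1_(`[0, h' x[ : set R) : measurableTypeR R -> R)).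
    by apply/measurable_EFinP; exact: measurable_indic.
  rewrite (@ge0_integralZl_EFin _ _ _ (@lebesgue_measure R) setT measurableT
    _ _ mI (w' x) (w'0 x)); last first.
    by move=> ? _; rewrite lee_fin.
  rewrite integral_indic ?setIT //.
  rewrite [X in (_ * X)%E](lebesgue_measure_itv `[0, h' x[) /= lte_fin.
  rewrite /w' /h' !patchE; case: ifPn => [/set_mem Kx|_]; last by rewrite mul0e.
  case: ltP => [_|hx]; first by rewrite -EFinD subr0 -EFinM.
  have -> : h x = 0 by apply: le_anti; rewrite hx h0.
  by rewrite mulr0 mule0.
rewrite FT [RHS]integral_mkcond; apply: eq_integral => s _.
rewrite patchE; case: ifPn => [/set_mem|/negP s0] /=.
  rewrite /= in_itv/= andbT => s0.
  rewrite [RHS]integral_mkcond; apply: eq_integral => x _.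
  rewrite /F/= /w' indicE patchE [in RHS]patchE.
  have [Kx|nKx] := pselect (K x); last first.
    by rewrite (memNset nKx) mul0r memNset// => -[].
  rewrite (mem_set Kx); have [sx|hs] := ltP s (h x).
    rewrite !mem_set ?mulr1//=; split => //.
    by rewrite /h' patchE mem_set.
  rewrite !memNset ?mulr0//=; first by case=> _; rewrite ltNge hs.
  by case=> _; rewrite /h' patchE mem_set// ltNge hs.
rewrite integral0_eq// => x _; rewrite /F/= indicE memNset ?mulr0//= => -[].
move=> sge0 _; apply: s0; rewrite inE/= in_itv/= andbT.
exact: sge0.
Qed.

Lemma bounded_on_le (T : Type) (R : realType) (K : set T) (f : T -> R) (M : R) :
  (forall x, K x -> `|f x| <= M) -> [bounded f x | x in K].
Proof.
move=> fM; exists M; split; first exact: num_real.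
by move=> y My x /= Kx; exact: le_trans (fM x Kx) (ltW My).
Qed.

Section weighted_integrals.
Context d (T : measurableType d) (R : realType).
Variable mu : {measure set T -> \bar R}.
Implicit Types (K : set T) (w f h : T -> R).

Lemma integrable_weighted K w f (M : R) : measurable K ->
  mu.-integrable K (EFin \o w) -> measurable_fun K f ->
  (forall x, K x -> `|f x| <= M) ->
  mu.-integrable K (EFin \o (fun x => w x * f x)).
Proof.
move=> mK iw mf fM.
have -> : EFin \o (fun x => w x * f x) = ((EFin \o w) \* (EFin \o f))%E.
  by apply/funext => x.
by apply: integrableMl => //; exact: bounded_on_le fM.
Qed.

Lemma Rintegral_weighted_near K w f (c eta : R) : measurable K ->
  mu.-integrable K (EFin \o w) -> (forall x, K x -> 0 <= w x) ->
  measurable_fun K f -> (forall x, K x -> `|f x - c| <= eta) ->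
  `|\int[mu]_(x in K) (w x * f x) - c * \int[mu]_(x in K) w x| <=
  eta * \int[mu]_(x in K) w x.
Proof.
move=> mK iw w0 mf fc.
have bf x : K x -> `|f x| <= eta + `|c|.
  move=> Kx; rewrite -[f x](subrK c) (le_trans (ler_normD _ _))// lerD2r.
  exact: fc.
have iwf := integrable_weighted mK iw mf bf.
have icw : mu.-integrable K (EFin \o (fun x => c * w x)).
  by apply: eq_integrable (integrableZl mK c iw) => // x _.
rewrite -(RintegralZl _ mK iw) -RintegralB//.
have iB : mu.-integrable K (EFin \o (fun x => w x * f x - c * w x)).
  by apply: eq_integrable (integrableB mK iwf icw) => // x _.
apply: le_trans (le_normr_Rintegral mK iB) _.
rewrite -(RintegralZl _ mK iw); apply: le_Rintegral => //.
- by apply: eq_integrable (integrable_abse iB) => // x _.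
- by apply: eq_integrable (integrableZl mK eta iw) => // x _.
- move=> x Kx; rewrite [c * _]mulrC -mulrBr normrM (ger0_norm (w0 _ Kx)) mulrC.
  by rewrite ler_wpM2r// ?w0// fc.
Qed.

Lemma Rintegral_near K f (c eta : R) : measurable K -> (mu K < +oo)%E ->
  measurable_fun K f -> (forall x, K x -> `|f x - c| <= eta) ->
  `|\int[mu]_(x in K) f x - c * fine (mu K)| <= eta * fine (mu K).
Proof.
move=> mK Koo mf fc.
have i1 : mu.-integrable K (EFin \o cst 1).
  apply: measurable_bounded_integrable => //.
  by apply: (@bounded_on_le _ _ _ _ 1) => x _; rewrite normr1.
have := Rintegral_weighted_near mK i1 (fun _ _ => ler01) mf fc.
rewrite Rintegral_cst// mul1r.
by under eq_Rintegral do rewrite mul1r.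
Qed.

End weighted_integrals.

Lemma Rintegral_layer_cake d (T : measurableType d) (R : realType)
    (mu : {sigma_finite_measure set T -> \bar R}) (K : set T) (w h : T -> R)
    (M : R) :
  measurable K -> mu.-integrable K (EFin \o w) -> (forall x, K x -> 0 <= w x) ->
  measurable_fun K h -> (forall x, K x -> `|h x| <= M) ->
  \int[mu]_(x in K) (w x * h x) =
  fine (\int[@lebesgue_measure R]_(s in `[0%R, +oo[)
     (\int[mu]_(x in K `&` [set x | s - M < h x]) w x)%:E)%E -
  M * \int[mu]_(x in K) w x.
Proof.
move=> mK iw w0 mh hM.
have mhM : measurable_fun K (fun x => h x + M).
  by apply: measurable_funD.
have iwh := integrable_weighted mK iw mh hM.
have iMw : mu.-integrable K (EFin \o (fun x => M * w x)).
  by apply: eq_integrable (integrableZl mK M iw) => // x _.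
have mw : measurable_fun K w by apply/measurable_EFinP; case/integrableP : iw.
rewrite -(RintegralZl _ mK iw); apply/eqP; rewrite eq_sym subr_eq; apply/eqP.
rewrite -RintegralD//; congr fine.
transitivity (\int[mu]_(x in K) (w x * (h x + M))%:E)%E; last first.
  by apply: eq_integral => x _; rewrite mulrDr [w x * M]mulrC.
rewrite integral_layer_cake//; last first.
  move=> x Kx; rewrite -lerBlDr sub0r.
  by have := hM x Kx; rewrite ler_norml => /andP[].
apply: eq_integral => s _.
have -> : [set x | s < h x + M] = [set x | s - M < h x].
  by apply/seteqP; split => x /=; rewrite ltrBlDr.
have mKs : measurable (K `&` [set x | s - M < h x]).
  have mlt : measurable_fun K (fun x => s - M < h x).
    by apply: measurable_fun_ltr.
  exact: (mlt mK [set true]).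
rewrite fineK//; apply: integrable_fin_num => //.
by apply: integrableS iw => //; exact: subIsetl.
Qed.

(** Two weighted integrals agree as soon as the level sets have equal weights.
    The bound [M] shifts the functions to nonnegative ones, and the total
    weights agree since [- M - 1 < h] holds everywhere. *)
Lemma eq_Rintegral_level_sets d (T : measurableType d) (R : realType)
    (mu : {sigma_finite_measure set T -> \bar R}) (K1 K2 : set T)
    (w1 w2 h1 h2 : T -> R) (M : R) :
  measurable K1 -> mu.-integrable K1 (EFin \o w1) ->
  (forall x, K1 x -> 0 <= w1 x) ->
  measurable_fun K1 h1 -> (forall x, K1 x -> `|h1 x| <= M) ->
  measurable K2 -> mu.-integrable K2 (EFin \o w2) ->
  (forall x, K2 x -> 0 <= w2 x) ->
  measurable_fun K2 h2 -> (forall x, K2 x -> `|h2 x| <= M) ->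
  (forall s, \int[mu]_(x in K1 `&` [set x | s < h1 x]) w1 x =
             \int[mu]_(x in K2 `&` [set x | s < h2 x]) w2 x) ->
  \int[mu]_(x in K1) (w1 x * h1 x) = \int[mu]_(x in K2) (w2 x * h2 x).
Proof.
move=> mK1 iw1 w10 mh1 hM1 mK2 iw2 w20 mh2 hM2 level.
rewrite (Rintegral_layer_cake mK1 iw1 w10 mh1 hM1).
rewrite (Rintegral_layer_cake mK2 iw2 w20 mh2 hM2).
under eq_integral do rewrite level.
(* The level below every value of [h] gives back the whole domain. *)
have full K h : (forall x : T, K x -> `|h x| <= M) ->
    K `&` [set x | - M - 1 < h x] = K.
  move=> hM; apply/setIidPl => x /hM; rewrite ler_norml => /andP[Mh _] /=.
  by apply: lt_le_trans Mh; rewrite ltrBlDr ltrDl.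
by have := level (- M - 1); rewrite !full// => ->.
Qed.

(** * Borel sets and volume in three dimensions *)

Lemma nbhs_rVP (R : realType) (n : nat) (x : 'rV[R]_n) (A : set 'rV[R]_n) :
  nbhs x A <-> exists2 e : R, 0 < e &
    forall y : 'rV[R]_n, (forall i, `|y 0 i - x 0 i| < e) -> A y.
Proof.
split=> [/nbhs_ballP[e /= e0 xeA]|[e e0 xeA]].
  exists e => // y yx; apply: xeA; split => // i j.
  by rewrite ord1 /ball/= distrC.
apply/nbhs_ballP; exists e => // y [_ yx]; apply: xeA => i.
by have := yx 0 i; rewrite /ball/= distrC.
Qed.

(** An open set is the countable union of the boxes with rational corners that it
    contains. *)
Lemma open_borel3 (R : realType) (O : set 'rV[R]_3) : open O -> borel3 O.
Proof.
move=> oO.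
pose itv (q : rat * rat) : set R := [set` `]ratr q.1, ratr q.2[%R].
pose box (q : rat * rat * (rat * rat) * (rat * rat)) : set (R * R * R) :=
  itv q.1.1 `*` itv q.1.2 `*` itv q.2.
pose F n := if unpickle n is Some q then
  if `[< box q `<=` @vec3 R @^-1` O >] then box q else set0 else set0.
rewrite /borel3; have -> : @vec3 R @^-1` O = \bigcup_n F n.
  apply/seteqP; split => [p Op|p [n _]]; last first.
    rewrite /F; case: unpickle => [q|[]].
    by case: ifPn => [/asboolP sub /sub|_ []].
  have /nbhs_rVP[e e0 Ov] : nbhs (vec3 p) O by apply: open_nbhs_nbhs.
  have rat2 (x : R) : exists q, [/\ x - e < ratr q.1, ratr q.1 < x,
      x < ratr q.2 & ratr q.2 < x + e].
    have /rat_in_itvoo[a] : x - e < x by rewrite ltrBlDr ltrDl.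
    have /rat_in_itvoo[b] : x < x + e by rewrite ltrDl.
    rewrite !in_itv/= => /andP[? ?] /andP[? ?].
    by exists (a, b).
  have [q1 [? ? ? ?]] := rat2 p.1.1.
  have [q2 [? ? ? ?]] := rat2 p.1.2.
  have [q3 [? ? ? ?]] := rat2 p.2.
  exists (pickle (q1, q2, q3)); [exact: I|rewrite /F pickleK].
  case: ifPn => [_|]; first by rewrite /box/itv/= !in_itv/=; split; [split|];
    apply/andP; split.
  move/asboolP => []; move=> z [[]] /=; rewrite /itv/= !in_itv/=.
  move=> /andP[? ?] /andP[? ?] /andP[? ?]; apply: Ov => i; rewrite !mxE.
  by move: i => [[|[|[|//]]] ?] /=; rewrite ltr_distl; apply/andP; split; lra.
apply: bigcupT_measurable => n; rewrite /F; case: unpickle => [q|//].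
by case: ifPn => // _; apply: measurableX; [apply: measurableX|];
  exact: measurable_itv.
Qed.

Lemma closed_borel3 (R : realType) (K : set 'rV[R]_3) : closed K -> borel3 K.
Proof.
move=> /closed_openC/open_borel3/measurableC.
by rewrite /borel3 -preimage_setC setCK.
Qed.

Lemma compact_borel3 (R : realType) (K : set 'rV[R]_3) : compact K -> borel3 K.
Proof.
move=> cK; apply: closed_borel3; apply: compact_closed cK.
exact: (@norm_hausdorff R 'rV[R]_3).
Qed.

Lemma measurable_fun_vec3 (R : realType) (Om K : set 'rV[R]_3)
    (f : 'rV[R]_3 -> R) : open Om -> {within Om, continuous f} ->
  borel3 K -> K `<=` Om ->
  measurable_fun (@vec3 R @^-1` K : set (measurableTypeR R * measurableTypeR R *
    measurableTypeR R)) (f \o @vec3 R).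
Proof.
move=> oOm; rewrite continuous_open_subspace// => /(continuous_inP _ oOm) cf.
move=> mK KOm.
have mf : measurable_fun (@vec3 R @^-1` Om : set (measurableTypeR R *
    measurableTypeR R * measurableTypeR R)) (f \o @vec3 R).
  apply: (measurability _ (RGenOpens.measurableE R)).
  move=> _ [_ [a [b ->] <-]].
  apply: (@open_borel3 R (Om `&` f @^-1` [set` `]a, b[%R])).
  by apply: cf; exact: interval_open.
apply: measurable_funS mf; first exact: open_borel3.
by move=> p; exact: KOm.
Qed.

Local Notation leb3 R :=
  ((@lebesgue_measure R \x @lebesgue_measure R) \x @lebesgue_measure R)%E.

Definition cube (R : realType) (x : 'rV[R]_3) (e : R) : set 'rV[R]_3 :=
  [set y | forall i, `|y 0 i - x 0 i| <= e].

Lemma cube_nbhs (R : realType) (x : 'rV[R]_3) (A : set 'rV[R]_3) :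
  nbhs x A -> \forall e \near 0^'+, cube x e `<=` A.
Proof.
move=> /nbhs_rVP[d d0 xdA]; near=> e => y xy; apply: xdA => i.
apply: le_lt_trans (xy i) _; near: e.
exact: nbhs_right_lt.
Unshelve. all: by end_near. Qed.

Lemma compact_cube (R : realType) (x : 'rV[R]_3) (e : R) : compact (cube x e).
Proof.
have := @rV_compact R 3 (fun i => `[x 0 i - e, x 0 i + e]%classic)
  (fun i => @segment_compact _ _ _).
congr compact; apply/seteqP; split => y /= xy i; have := xy i;
  by rewrite /= in_itv/= ler_distl.
Qed.

Lemma leb3_cube (R : realType) (x : 'rV[R]_3) (e : R) : 0 <= e ->
  leb3 R (@vec3 R @^-1` cube x e) = ((2 * e) ^+ 3)%:E.
Proof.
move=> e0.
pose itv i : set (measurableTypeR R) := [set` `[x 0 i - e, x 0 i + e]%R].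
have lebitv i : lebesgue_measure (itv i) = (2 * e)%:E.
  rewrite /itv [LHS](lebesgue_measure_itv `[x 0 i - e, x 0 i + e])/= lte_fin.
  case: ltP => ee; first by rewrite -EFinD; congr EFin; ring.
  by congr EFin; lra.
have mitv i : measurable (itv i) by exact: measurable_itv.
have -> : @vec3 R @^-1` cube x e = itv 0 `*` itv 1 `*` itv 2%:R.
  apply/seteqP; split => [p pe|p [[/= p0 p1] p2] i].
    have := pe 0; have := pe 1; have := pe 2%:R.
    by rewrite !mxE/= !ler_distl /itv/= !in_itv/= => -> -> ->.
  rewrite ler_distl; move: p0 p1 p2; rewrite /itv/= !in_itv/= => p0 p1 p2.
  case: i => [[|[|[|//]]] i3]; rewrite mxE/=.
  - by rewrite (_ : Ordinal i3 = 0)//; apply/val_inj.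
  - by rewrite (_ : Ordinal i3 = 1)//; apply/val_inj.
  - by rewrite (_ : Ordinal i3 = 2%:R)//; apply/val_inj.
rewrite product_measure1E//; last exact: measurableX.
rewrite [X in (X * _)%E](_ : _ =
  (lebesgue_measure (itv 0%R) * lebesgue_measure (itv 1%R))%E).
  rewrite !lebitv [X in (_ * X)%E](lebitv 2%:R) -!EFinM; congr EFin; ring.
exact: product_measure1E.
Qed.

Lemma leb3_compact (R : realType) (K : set 'rV[R]_3) : compact K ->
  (leb3 R (@vec3 R @^-1` K) < +oo)%E.
Proof.
move=> cK; have [M [_ KM]] := compact_bounded cK.
pose e := `|M| + 1.
have Ke : K `<=` cube 0 e.
  move=> y Ky i; rewrite mxE subr0.
  have /KM/(_ _ Ky) : M < e by rewrite (le_lt_trans (ler_norm _))// ltrDl.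
  apply: le_trans; rewrite [leRHS]/Num.Def.normr/= mx_normrE.
  exact: (le_bigmax _ (fun ij : 'I_1 * 'I_3 => `|y ij.1 ij.2|) (0, i)).
apply: le_lt_trans (_ : leb3 R (@vec3 R @^-1` cube 0 e) < _)%E.
  apply: le_measure; rewrite ?inE.
  - exact: (compact_borel3 cK).
  - exact: (compact_borel3 (@compact_cube R 0 e)).
  - by move=> p; exact: Ke.
by rewrite leb3_cube ?ltry// addr_ge0.
Qed.

Lemma sigma_finite_leb3 (R : realType) : sigma_finite setT (leb3 R).
Proof.
exists (fun n => @vec3 R @^-1` cube 0 n%:R).
  apply/esym; rewrite -subTset => p _.
  have [n pn] : exists n, \sum_i `|vec3 p 0 i| < n%:R.
    by exists (Num.truncn (\sum_i `|vec3 p 0 i|)).+1; exact: truncnS_gt.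
  exists n => // i; rewrite [X in _ - X]mxE subr0; apply: le_trans (ltW pn).
  by rewrite (bigD1 i)//= lerDl sumr_ge0.
move=> n; split; last by rewrite leb3_cube// ltry.
exact: (compact_borel3 (@compact_cube R 0 n%:R)).
Qed.

(** A head constant of its own for the volume measure, so that inference finds
    its sigma-finiteness: the instances keyed on the product of measures concern
    products of subprobabilities. *)
Definition volume_measure (R : realType) :
  set (measurableTypeR R * measurableTypeR R * measurableTypeR R) -> \bar R :=
  leb3 R.

HB.instance Definition _ (R : realType) := Measure.on (@volume_measure R).

HB.instance Definition _ (R : realType) :=
  Measure_isSigmaFinite.Build _ _ _ (@volume_measure R) (sigma_finite_leb3 R).

Lemma continuous_on_compact_bounded (R : realType) (Om K : set 'rV[R]_3)
    (f : 'rV[R]_3 -> R) : {within Om, continuous f} -> compact K -> K `<=` Om ->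
  exists M, forall x, K x -> `|f x| <= M.
Proof.
move=> cf cK KOm.
have /compact_bounded[M [_ fM]] :=
  continuous_compact (continuous_subspaceW KOm cf) cK.
exists (`|M| + 1) => x Kx; apply: (fM (`|M| + 1)); last by exists x.
by rewrite (le_lt_trans (ler_norm _))// ltrDl.
Qed.

Lemma integrable_vec3 (R : realType) (Om K : set 'rV[R]_3)
    (f : 'rV[R]_3 -> R) : open Om -> {within Om, continuous f} ->
  compact K -> K `<=` Om ->
  (leb3 R).-integrable (@vec3 R @^-1` K) (EFin \o (f \o @vec3 R)).
Proof.
move=> oOm cf cK KOm; have mK := compact_borel3 cK.
have [M fM] := continuous_on_compact_bounded cf cK KOm.
apply: measurable_bounded_integrable => //; first exact: leb3_compact.
  exact: measurable_fun_vec3 cf mK KOm.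
by apply: (@bounded_on_le _ _ _ _ M) => p /fM.
Qed.

(** * Transport of mass by the motion *)

Lemma open_setX (T U : topologicalType) (A : set T) (B : set U) :
  open A -> open B -> open (A `*` B).
Proof.
move=> oA oB; rewrite openE => p [/= Ap Bp]; exists (A, B) => //.
by split; exact: open_nbhs_nbhs.
Qed.

Section kinematics.
Variables (R : realType) (J : set R) (B0 : set 'rV[R]_3).
Variable u : R -> 'rV[R]_3 -> 'rV[R]_3.
Hypotheses (oJ : open J) (regu : regular_motion J B0 u).

Lemma particleK t X : J t -> B0 X -> particle B0 u t (motion u t X) = X.
Proof.
move=> Jt B0X; have [_ /(_ t Jt)[inj _ _] _ _] := regu.
by rewrite /particle pinvKV// inE.
Qed.

Lemma motion_particle t x : configuration B0 u t x ->
  motion u t (particle B0 u t x) = x.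
Proof. by move=> tx; rewrite /particle pinvK// inE. Qed.

Lemma particle_ref t x : J t -> configuration B0 u t x ->
  B0 (particle B0 u t x).
Proof. by move=> Jt [X B0X <-]; rewrite particleK. Qed.

Lemma continuous_time_slice (V : topologicalType) (f : R * 'rV[R]_3 -> V) t :
  {within J `*` B0, continuous f} -> J t ->
  {within B0, continuous (fun X => f (t, X))}.
Proof.
move=> cf Jt; have [oB0 _ _ _] := regu.
rewrite continuous_open_subspace// => X; rewrite inE => B0X.
move: cf; rewrite continuous_open_subspace; last exact: open_setX.
move=> /(_ (t, X)); rewrite inE => /(_ (conj Jt B0X)) cf.
apply: (@continuous_comp _ _ _ (pair t) f) => //.
exact: (cvg_pair (@cvg_cst _ t _ (nbhs X) _) (@cvg_id _ (nbhs X))).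
Qed.

Lemma continuous_motion t : J t -> {within B0, continuous (motion u t)}.
Proof.
move=> Jt; have [oB0 _ _ [cu _ _]] := regu.
have := continuous_time_slice cu Jt.
rewrite !continuous_open_subspace// => cut X B0X.
have cid : {for X, continuous (@id 'rV[R]_3)} by exact: cvg_id.
exact: (continuousD cid (cut X B0X)).
Qed.

Lemma continuous_comp_particle (V : topologicalType) (g : 'rV[R]_3 -> V) t :
  J t -> {within B0, continuous g} ->
  {within configuration B0 u t, continuous (g \o particle B0 u t)}.
Proof.
move=> Jt; have [oB0 /(_ t Jt)[_ oBt cp] _ _] := regu.
rewrite !continuous_open_subspace// in cp *.
move=> cg x tx; apply: continuous_comp; first exact: cp.
by apply: cg; rewrite inE; apply: particle_ref => //; exact: set_mem.
Qed.

Lemma compact_motion P t : compact P -> P `<=` B0 -> J t ->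
  compact (motion u t @` P).
Proof.
move=> cP PB0 Jt; apply: continuous_compact cP.
by apply: continuous_subspaceW PB0 _; exact: continuous_motion.
Qed.

Lemma compact_particle K t : compact K -> K `<=` configuration B0 u t -> J t ->
  compact (particle B0 u t @` K).
Proof.
move=> cK Kt Jt; apply: continuous_compact cK; apply: continuous_subspaceW Kt _.
by have [_ /(_ t Jt)[]] := regu.
Qed.

Lemma compact_part P : compact P -> P `<=` B0 -> part B0 P.
Proof.
move=> cP PB0; have := compact_closed (@norm_hausdorff R 'rV[R]_3) cP.
move=> /closure_id Pcl; rewrite /part -Pcl; split => //.
exact: compact_borel3.
Qed.

(** The level sets of a continuous function in a compact part are parts: this is
    what lets mass conservation act on integrals of functions. *)
Lemma part_level P (g : 'rV[R]_3 -> R) s : compact P -> P `<=` B0 ->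
  {within B0, continuous g} -> part B0 (P `&` [set X | s < g X]).
Proof.
move=> cP PB0; have [oB0 _ _ _] := regu.
rewrite continuous_open_subspace// => /(continuous_inP _ oB0) cg.
have clP := compact_closed (@norm_hausdorff R 'rV[R]_3) cP.
have sub : closure (P `&` [set X | s < g X]) `<=` P.
  rewrite [X in _ `<=` X](closure_id P).1//.
  by apply: closureS; exact: subIsetl.
split; last by move=> X /sub /PB0.
  have -> : P `&` [set X | s < g X] = P `&` (B0 `&` g @^-1` [set x | s < x]).
    apply/seteqP; split=> [X [PX sX]|X [PX [_ sX]]]; split => //.
    by split => //; exact: PB0.
  apply: measurableI; first exact: (compact_borel3 cP).
  by apply: (@open_borel3 R (B0 `&` _)); apply: cg; exact: open_gt.
apply: subclosed_compact sub => //; exact: closed_closure.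
Qed.

Variable rho : R -> 'rV[R]_3 -> R.
Hypothesis rho0 : forall t x, J t -> configuration B0 u t x -> 0 <= rho t x.
Hypothesis crho :
  forall t, J t -> {within configuration B0 u t, continuous (rho t)}.
Hypothesis mass : mass_conservation J B0 u rho.

(** Conservation of mass for an observable [g] of the particles, from its special
    case of indicators of parts, by comparison of level sets. *)
Lemma mass_transport P (g : 'rV[R]_3 -> R) s t : compact P -> P `<=` B0 ->
  {within B0, continuous g} -> J s -> J t ->
  volume_integral (motion u s @` P)
    (fun x => rho s x * g (particle B0 u s x)) =
  volume_integral (motion u t @` P)
    (fun x => rho t x * g (particle B0 u t x)).
Proof.
move=> cP PB0 cg Js Jt.
have [M gM] := continuous_on_compact_bounded cg cP PB0.
have sub r : motion u r @` P `<=` configuration B0 u r by exact: image_subset.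
have op r : J r -> open (configuration B0 u r).
  by move=> Jr; have [_ /(_ r Jr)[]] := regu.
have hM r x : J r -> (motion u r @` P) x -> `|g (particle B0 u r x)| <= M.
  by move=> Jr [X PX <-]; rewrite particleK//; [exact: gM|exact: PB0].
have level r a : J r -> @vec3 R @^-1` (motion u r @` P) `&`
      [set p | a < g (particle B0 u r (vec3 p))] =
    @vec3 R @^-1` (motion u r @` (P `&` [set X | a < g X])).
  move=> Jr; apply/seteqP; split=> [p [[X PX Xp]] /=|p [X [PX aX] Xp]] /=.
    by rewrite -Xp particleK; [exists X|by []|exact: PB0].
  by split; [exists X|rewrite -Xp particleK//; exact: PB0].
have := (@eq_Rintegral_level_sets _ _ _ (@volume_measure R)
  (@vec3 R @^-1` (motion u s @` P)) (@vec3 R @^-1` (motion u t @` P))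
  (rho s \o @vec3 R)
  (rho t \o @vec3 R) ((g \o particle B0 u s) \o @vec3 R)
  ((g \o particle B0 u t) \o @vec3 R) M); apply.
- exact: (compact_borel3 (compact_motion cP PB0 Js)).
- exact: (integrable_vec3 (op s Js) (crho Js) (compact_motion cP PB0 Js)).
- by move=> p /sub; exact: rho0.
- apply: (measurable_fun_vec3 (op s Js) (continuous_comp_particle Js cg)) => //.
  exact: (compact_borel3 (compact_motion cP PB0 Js)).
- by move=> p; exact: hM.
- exact: (compact_borel3 (compact_motion cP PB0 Jt)).
- exact: (integrable_vec3 (op t Jt) (crho Jt) (compact_motion cP PB0 Jt)).
- by move=> p /sub; exact: rho0.
- apply: (measurable_fun_vec3 (op t Jt) (continuous_comp_particle Jt cg)) => //.
  exact: (compact_borel3 (compact_motion cP PB0 Jt)).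
- by move=> p; exact: hM.
move=> a; rewrite !level//.
exact: mass (part_level a cP PB0 cg) Js Jt.
Qed.

End kinematics.

(** * The faces of a cube *)

Lemma ord3_cases (i j : 'I_3) : [\/ j = i, j = i + 1 | j = i + 2%:R].
Proof.
case: i j => [[|[|[|//]]] ?] [[|[|[|//]]] ?];
  by [apply: Or31; apply/val_inj|apply: Or32; apply/val_inj|
      apply: Or33; apply/val_inj].
Qed.

Lemma ord3_neq (i : 'I_3) :
  [/\ i + 1 == i = false, i + 2%:R == i = false & i + 2%:R == i + 1 = false].
Proof. by case: i => [[|[|[|//]]] ?]. Qed.

Lemma is_derive_affine (R : realType) (A v : 'rV[R]_3) (t : R) :
  is_derive t 1 (fun s => A + s *: v) v.
Proof.
have lim : h^-1 *: ((A + (h *: 1 + t) *: v) - (A + t *: v)) @[h --> 0^'] --> v.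
  apply: cvg_near_cst; near=> h.
  rewrite [h *: 1]mulr1 [A + (h + t) *: v]addrC addrKA scalerDl addrK.
  rewrite scalerA mulVf ?scale1r//.
  by near: h; exact: nbhs_dnbhs_neq.
by apply: DeriveDef; [apply/cvg_ex; exists v|exact: cvg_lim lim].
Unshelve. all: by end_near. Qed.

Section affine_patch.
Variables (R : realType) (A v w : 'rV[R]_3).

Definition affine_patch (p : R * R) : 'rV[R]_3 := A + p.1 *: v + p.2 *: w.

Lemma is_derive_affine_patch1 (p : R * R) :
  is_derive p.1 1 (fun s => affine_patch (s, p.2)) v.
Proof.
rewrite /affine_patch /=.
under eq_fun do rewrite addrAC.
exact: is_derive_affine.
Qed.

Lemma is_derive_affine_patch2 (p : R * R) :
  is_derive p.2 1 (fun s => affine_patch (p.1, s)) w.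
Proof. by rewrite /affine_patch /=; exact: is_derive_affine. Qed.

Lemma tangent1_affine_patch p : tangent1 affine_patch p = v.
Proof. by rewrite /tangent1 derive1E; have [] := is_derive_affine_patch1 p. Qed.

Lemma tangent2_affine_patch p : tangent2 affine_patch p = w.
Proof. by rewrite /tangent2 derive1E; have [] := is_derive_affine_patch2 p. Qed.

Lemma C1_affine_patch : C1_patch affine_patch.
Proof.
exists setT; split => //; first exact: openT.
- move=> p _; split.
    by have [] := is_derive_affine_patch1 p.
  by have [] := is_derive_affine_patch2 p.
- apply: continuous_subspaceT; rewrite (_ : tangent1 _ = cst v).
    by move=> p; exact: cvg_cst.
  by apply/funext => p; rewrite tangent1_affine_patch.
- apply: continuous_subspaceT; rewrite (_ : tangent2 _ = cst w).
    by move=> p; exact: cvg_cst.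
  by apply/funext => p; rewrite tangent2_affine_patch.
Qed.

Lemma area_vector_affine_patch p : area_vector affine_patch p = cross v w.
Proof.
by rewrite /area_vector tangent1_affine_patch tangent2_affine_patch.
Qed.

End affine_patch.

(** The point of the section of the cube orthogonal to the [i]-th axis, at signed
    distance [c] from the centre, with parameters [a] and [b] in the unit square
    along the next two axes.  The values [e] and [- e] of [c] give the faces. *)
Definition face_point (R : realType) (x : 'rV[R]_3) (e c : R) (i : 'I_3)
    (a b : R) : 'rV[R]_3 :=
  \row_(j < 3) (x 0 j + (if j == i then c else
    e * (2 * (if j == i + 1 then a else b) - 1))).

Section cube_faces.
Variables (R : realType) (x : 'rV[R]_3) (e : R).
Local Notation axis i := (delta_mx 0 i : 'rV[R]_3).

(** The cross product of the axes [i + 1] and [i + 2] is the axis [i], which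
    points outward on the upper face; on the lower face, exchanging the two
    parameters reverses the orientation. *)
Definition upper_face (i : 'I_3) : R * R -> 'rV[R]_3 :=
  affine_patch (x + e *: axis i - e *: axis (i + 1) - e *: axis (i + 2%:R))
    ((2 * e) *: axis (i + 1)) ((2 * e) *: axis (i + 2%:R)).

Definition lower_face (i : 'I_3) : R * R -> 'rV[R]_3 :=
  affine_patch (x - e *: axis i - e *: axis (i + 1) - e *: axis (i + 2%:R))
    ((2 * e) *: axis (i + 2%:R)) ((2 * e) *: axis (i + 1)).

Definition cube_face (k : 'I_(3 + 3)) : R * R -> 'rV[R]_3 :=
  match fintype.split k with inl i => upper_face i | inr i => lower_face i end.

Lemma upper_faceE i p : upper_face i p = face_point x e e i p.1 p.2.
Proof.
apply/rowP => j; rewrite !mxE eqxx /=.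
have [n1 n2 n3] := ord3_neq i.
have [->|->|->] := ord3_cases i j.
- by rewrite eqxx ![i == _]eq_sym n1 n2 /=; ring.
- by rewrite eqxx n1 [i + 1 == _]eq_sym n3 /=; ring.
- by rewrite eqxx n2 n3 /=; ring.
Qed.

Lemma lower_faceE i p : lower_face i p = face_point x e (- e) i p.2 p.1.
Proof.
apply/rowP => j; rewrite !mxE eqxx /=.
have [n1 n2 n3] := ord3_neq i.
have [->|->|->] := ord3_cases i j.
- by rewrite eqxx ![i == _]eq_sym n1 n2 /=; ring.
- by rewrite eqxx n1 [i + 1 == _]eq_sym n3 /=; ring.
- by rewrite eqxx n2 n3 /=; ring.
Qed.

Lemma cross_axes (i : 'I_3) (a : R) :
  cross (a *: axis (i + 1)) (a *: axis (i + 2%:R)) = a ^+ 2 *: axis i.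
Proof.
apply/rowP => j; rewrite !mxE eqxx /=.
by case: i j => [[|[|[|//]]] ?] [[|[|[|//]]] ?] /=; ring.
Qed.

Lemma crossC (v w : 'rV[R]_3) : cross v w = - cross w v.
Proof. by apply/rowP => j; rewrite !mxE; ring. Qed.

Lemma area_upper_face i p :
  area_vector (upper_face i) p = (2 * e) ^+ 2 *: axis i.
Proof. by rewrite area_vector_affine_patch cross_axes. Qed.

Lemma area_lower_face i p :
  area_vector (lower_face i) p = - ((2 * e) ^+ 2 *: axis i).
Proof. by rewrite area_vector_affine_patch crossC cross_axes. Qed.

Lemma enorm_axis (i : 'I_3) (a : R) : enorm (a *: axis i) = `|a|.
Proof.
rewrite /enorm (bigD1 i)//= big1 ?addr0; last first.
  by move=> j ji; rewrite !mxE eqxx (negPf ji) mulr0 expr0n.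
by rewrite !mxE !eqxx mulr1 sqrtr_sqr.
Qed.

Hypothesis e0 : 0 < e.

Lemma enorm_area_upper_face i p :
  enorm (area_vector (upper_face i) p) = (2 * e) ^+ 2.
Proof. by rewrite area_upper_face enorm_axis ger0_norm// sqr_ge0. Qed.

Lemma enorm_area_lower_face i p :
  enorm (area_vector (lower_face i) p) = (2 * e) ^+ 2.
Proof.
by rewrite area_lower_face -scaleNr enorm_axis normrN ger0_norm// sqr_ge0.
Qed.

Lemma unit_normal_upper_face i p : unit_normal (upper_face i) p = axis i.
Proof.
rewrite /unit_normal enorm_area_upper_face area_upper_face scalerA.
by rewrite mulVf ?scale1r// sqrf_eq0 mulf_neq0// gt_eqF.
Qed.

Lemma unit_normal_lower_face i p : unit_normal (lower_face i) p = - axis i.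
Proof.
rewrite /unit_normal enorm_area_lower_face area_lower_face scalerN scalerA.
by rewrite mulVf ?scale1r// sqrf_eq0 mulf_neq0// gt_eqF.
Qed.

End cube_faces.

Section cube_boundary.
Variables (R : realType) (x : 'rV[R]_3) (e : R).
Hypothesis e0 : 0 < e.
Local Notation axis i := (delta_mx 0 i : 'rV[R]_3).

Lemma face_point0 c i a b : face_point x e c i a b 0 i = x 0 i + c.
Proof. by rewrite mxE eqxx. Qed.

Lemma face_point1 c i a b :
  face_point x e c i a b 0 (i + 1) = x 0 (i + 1) + e * (2 * a - 1).
Proof. by have [n1 _ _] := ord3_neq i; rewrite mxE n1 eqxx. Qed.

Lemma face_point2 c i a b :
  face_point x e c i a b 0 (i + 2%:R) = x 0 (i + 2%:R) + e * (2 * b - 1).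
Proof. by have [_ n2 n3] := ord3_neq i; rewrite mxE n2 n3. Qed.

Lemma face_point_cube c i a b : `|c| <= e -> 0 <= a <= 1 -> 0 <= b <= 1 ->
  cube x e (face_point x e c i a b).
Proof.
move=> ce a01 b01 j; rewrite mxE addrAC subrr add0r.
case: ifP => // _; rewrite normrM (gtr0_norm e0) ger_pMr// ler_norml.
by case: ifP => _; lra.
Qed.

Lemma face_point_strict c i a b j : j != i -> 0 < a < 1 -> 0 < b < 1 ->
  `|face_point x e c i a b 0 j - x 0 j| < e.
Proof.
move=> /negPf ji a01 b01; rewrite mxE addrAC subrr add0r ji.
rewrite normrM (gtr0_norm e0) gtr_pMr// ltr_norml.
by case: ifP => _; lra.
Qed.

(** The axis of the face is the only one along which the point is at distance [e]
    from the centre, as [a] and [b] are strictly inside the unit interval. *)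
Lemma face_point_inj c c' i i' a a' b b' : `|c| = e -> `|c'| = e ->
  0 < a < 1 -> 0 < b < 1 -> 0 < a' < 1 -> 0 < b' < 1 ->
  face_point x e c i a b = face_point x e c' i' a' b' ->
  [/\ i = i', c = c', a = a' & b = b'].
Proof.
move=> ce ce' a01 b01 a01' b01' E.
have ii : i = i'.
  apply/eqP; case: (eqVneq i i') => // ii'.
  have := face_point_strict c' ii' a01' b01'.
  by rewrite -E face_point0 addrAC subrr add0r ce ltxx.
rewrite -{}ii in E *.
have inj a1 a2 : e * (2 * a1 - 1) = e * (2 * a2 - 1) -> a1 = a2.
  by move=> /(mulfI (lt0r_neq0 e0)) h; lra.
split => //.
- by have := congr1 (fun y : 'rV_3 => y 0 i) E; rewrite !face_point0 => /addrI.
- have := congr1 (fun y : 'rV_3 => y 0 (i + 1)) E.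
  by rewrite !face_point1 => /addrI/inj.
- have := congr1 (fun y : 'rV_3 => y 0 (i + 2%:R)) E.
  by rewrite !face_point2 => /addrI/inj.
Qed.

Lemma cube_face_pointE y i : cube x e y -> exists a b,
  [/\ 0 <= a <= 1, 0 <= b <= 1 &
      y = face_point x e (y 0 i - x 0 i) i a b].
Proof.
move=> ye; pose f j := (1 + (y 0 j - x 0 j) / e) / 2.
have f01 j : 0 <= f j <= 1.
  have : `|(y 0 j - x 0 j) / e| <= 1.
    by rewrite normrM normfV (gtr0_norm e0) ler_pdivrMr// mul1r.
  by rewrite ler_norml /f; lra.
have ef j : y 0 j = x 0 j + e * (2 * f j - 1).
  by rewrite /f; field; rewrite gt_eqF.
exists (f (i + 1)), (f (i + 2%:R)); split => //; apply/rowP => j.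
have [->|->|->] := ord3_cases i j;
  rewrite ?face_point0 ?face_point1 ?face_point2//.
by rewrite addrC subrK.
Qed.

Lemma frontier_cube :
  frontier (cube x e) = cube x e `&` [set y | exists i, `|y 0 i - x 0 i| = e].
Proof.
have clc := compact_closed (@norm_hausdorff R 'rV[R]_3) (@compact_cube R x e).
rewrite /frontier -((closure_id _).1 clc); apply/seteqP; split => y [ye].
  move=> nint; split => //; apply: contrapT => neq; apply: nint.
  rewrite /interior; near=> z; move=> i; apply/ltW; move: i; near: z.
  apply: filter_forall => i.
  have lt : `|y 0 i - x 0 i| < e.
    rewrite lt_neqAle ye andbT; apply/eqP => yi.
    by apply: neq; exists i.
  have lim : `|z 0 i - x 0 i| @[z --> y] --> `|y 0 i - x 0 i|.
    apply: cvg_norm; apply: cvgB; last exact: cvg_cst.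
    exact: (@coord_continuous R 1 3 0 i).
  by apply: (cvgr_lt _ lim).
move=> [i yi]; split => // /nbhs_rVP[d d0 yd].
(* Moving [y] away from the centre along the [i]-th axis by [d / 2] leaves the
   cube. *)
pose t := d / (2 * e); have t0 : 0 < t by rewrite divr_gt0// mulr_gt0.
have te : t * e = d / 2 by rewrite /t; field; rewrite gt_eqF.
pose z := y + (t * (y 0 i - x 0 i)) *: axis i.
have /(_ i) : cube x e z.
  apply: yd => j; rewrite !mxE eqxx addrAC subrr add0r/= -[_ == _]/(j == i).
  case: (j == i); last by rewrite mulr0 normr0.
  rewrite mulr1 normrM yi gtr0_norm// te.
  by rewrite ltr_pdivrMr// mulr2n mulrDr mulr1 ltrDl.
rewrite !mxE !eqxx mulr1 addrAC -[X in X + _]mul1r -mulrDl normrM yi.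
by rewrite ger0_norm ?addr_ge0 ?(ltW t0)// leNgt ltr_pMl// ltrDl t0.
Unshelve. all: by end_near. Qed.

(** Leaving along the normal increases the distance to the centre beyond [e];
    in the opposite direction one stays inside up to the opposite face, which
    gives the range [2 * e]. *)
Lemma outward_face s i a b : `|s| = 1 -> 0 <= a <= 1 -> 0 <= b <= 1 ->
  outward (cube x e) (face_point x e (s * e) i a b) (s *: axis i).
Proof.
move=> s1 a01 b01; exists (2 * e); first by rewrite mulr_gt0.
move=> r /andP[r0 re]; rewrite scalerA; split.
  move=> /(_ i); rewrite !mxE !eqxx mulr1 addrAC [_ + s * e]addrC addrK.
  rewrite [s * e]mulrC -mulrDl normrM s1 mulr1 gtr0_norm ?addr_gt0//.
  by rewrite leNgt ltrDl r0.
have se : `|s * e| <= e by rewrite normrM s1 mul1r gtr0_norm.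
move=> j; have := face_point_cube i se a01 b01 j.
rewrite !mxE eqxx /=; case: (eqVneq j i) => [->|_]; last first.
  by rewrite mulr0 subr0.
move=> _; rewrite mulr1 addrAC [_ + s * e]addrC addrK [r * s]mulrC -mulrBr.
by rewrite normrM s1 mul1r ler_norml; lra.
Qed.

Lemma piecewise_C1_cube : piecewise_C1_boundary (cube x e) (cube_face x e).
Proof.
have ne : `|- e| = e by rewrite normrN gtr0_norm.
have pe : `|e| = e by rewrite gtr0_norm.
have open01 (p : R * R) : open_square p -> 0 < p.1 < 1 /\ 0 < p.2 < 1.
  by move=> []; rewrite /= !in_itv.
have w01 (a : R) : 0 < a < 1 -> 0 <= a <= 1.
  by move=> /andP[? ?]; rewrite !ltW.
split.
- move=> k; rewrite /cube_face.
  by case: fintype.split => i; exact: C1_affine_patch.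
- rewrite frontier_cube; apply/seteqP.
  split=> [y [ye [i yi]]|y [k _ [p psq <-]]].
    have [a [b [a01 b01 ->]]] := cube_face_pointE i ye.
    move/eqP: yi; rewrite eqr_norml => /andP[/orP[/eqP->|/eqP->] _].
      exists (lshift 3 i) => //; exists (a, b).
        by rewrite /square/= !in_itv/=; split.
      by rewrite /cube_face (unsplitK (inl i)) upper_faceE.
    exists (rshift 3 i) => //; exists (b, a).
      by rewrite /square/= !in_itv/=; split.
    by rewrite /cube_face (unsplitK (inr i)) lower_faceE.
  move: psq; rewrite /square/= !in_itv/= => -[p1 p2].
  rewrite /cube_face; case: fintype.split => i.
    rewrite upper_faceE; split; first by apply: face_point_cube; rewrite ?pe.
    by exists i; rewrite face_point0 addrAC subrr add0r.
  rewrite lower_faceE; split; first by apply: face_point_cube; rewrite ?ne.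
  by exists i; rewrite face_point0 addrAC subrr add0r.
- move=> k l [a b] [a' b'] /open01[/= p1 p2] /open01[/= q1 q2].
  have nen : - e <> e by move=> ?; have := e0; lra.
  rewrite /cube_face -[k]splitK -[l]splitK !unsplitK.
  case: (fintype.split k) => i; case: (fintype.split l) => j;
    rewrite ?upper_faceE ?lower_faceE /= => E.
  + by have [-> _ -> ->] := face_point_inj pe pe p1 p2 q1 q2 E.
  + by have [_ /esym/nen] := face_point_inj pe ne p1 p2 q2 q1 E.
  + by have [_ /nen] := face_point_inj ne pe p2 p1 q1 q2 E.
  + by have [-> _ -> ->] := face_point_inj ne ne p2 p1 q2 q1 E.
- have ne0 : (2 * e) ^+ 2 <> 0.
    by apply/eqP; rewrite sqrf_eq0 mulf_neq0// gt_eqF.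
  move=> k p _; rewrite /cube_face; apply/eqP => /(congr1 (@enorm R)).
  rewrite -(scale0r (axis 0)) enorm_axis normr0.
  case: (fintype.split k) => i.
    by rewrite enorm_area_upper_face.
  by rewrite enorm_area_lower_face.
- move=> k p /open01[/w01 p1 /w01 p2]; rewrite /cube_face.
  case: fintype.split => i.
    rewrite unit_normal_upper_face// upper_faceE -[X in face_point _ _ X]mul1r.
    by rewrite -[axis i]scale1r; apply: outward_face; rewrite ?normr1.
  rewrite unit_normal_lower_face// lower_faceE -[X in face_point _ _ X]mulN1r.
  by rewrite -[- axis i]scaleN1r; apply: outward_face; rewrite ?normrN ?normr1.
Qed.

End cube_boundary.

(** * The flux through the boundary of a cube *)

Local Notation leb2 R := (@lebesgue_measure R \x @lebesgue_measure R)%E.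

Lemma measurable_square (R : realType) :
  measurable (@square R : set (measurableTypeR R * measurableTypeR R)).
Proof. by apply: measurableX; exact: measurable_itv. Qed.

Lemma leb2_square (R : realType) : leb2 R (@square R) = 1%E.
Proof.
rewrite product_measure1E//; try exact: measurable_itv.
by rewrite [X in (X * _)%E](lebesgue_measure_itv `[0, 1])
  [X in (_ * X)%E](lebesgue_measure_itv `[0, 1])/= lte_fin ltr01 sube0 mule1.
Qed.

Lemma integrable_square (R : realType) (f : R * R -> R) (M : R) :
  measurable_fun (@square R : set (measurableTypeR R * measurableTypeR R)) f ->
  (forall p, square p -> `|f p| <= M) ->
  (leb2 R).-integrable (@square R) (EFin \o f).
Proof.
move=> mf fM; apply: measurable_bounded_integrable => //.
- exact: measurable_square.
- by rewrite [X in (X < _)%E]leb2_square ltry.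
- exact: bounded_on_le fM.
Qed.

Lemma measurable_square_swap (R : realType) (f : R * R -> R) :
  measurable_fun (@square R : set (measurableTypeR R * measurableTypeR R)) f ->
  measurable_fun (@square R : set (measurableTypeR R * measurableTypeR R))
    (fun p => f (p.2, p.1)).
Proof.
move=> mf; pose sw (p : measurableTypeR R * measurableTypeR R) :
  measurableTypeR R * measurableTypeR R := (p.2, p.1).
have msw : measurable_fun setT sw.
  exact: measurable_fun_pair measurable_snd measurable_fst.
apply: (measurable_comp (F := @square R) (f := f) (g := sw)) => //.
- exact: measurable_square.
- by move=> _ [p [p1 p2] <-]; split.
- exact: measurable_funTS.
Qed.

(** The exchange of coordinates preserves the area; this undoes the exchange of
    parameters on the lower faces, so that opposite faces can be subtracted
    pointwise. *)
Lemma Rintegral_square_swap (R : realType) (f : R * R -> R) (M : R) :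
  measurable_fun (@square R : set (measurableTypeR R * measurableTypeR R)) f ->
  (forall p, square p -> `|f p| <= M) ->
  \int[leb2 R]_(p in @square R) f (p.2, p.1) =
  \int[leb2 R]_(p in @square R) f p.
Proof.
move=> mf fM; have msq := @measurable_square R.
pose sw (p : measurableTypeR R * measurableTypeR R) :
  measurableTypeR R * measurableTypeR R := (p.2, p.1).
have msw : measurable_fun setT sw.
  exact: measurable_fun_pair measurable_snd measurable_fst.
pose g : measurableTypeR R * measurableTypeR R -> R := f \_ (@square R).
have mg : measurable_fun setT g by apply/(measurable_restrictT _ msq).
have gM p : `|g p| <= `|M|.
  rewrite /g patchE; case: ifPn => [/set_mem/fM|_]; last by rewrite normr0.
  by move=> /le_trans; apply; exact: ler_norm.
have gsw : (fun p => f (p.2, p.1)) \_ (@square R) = g \o sw.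
  apply/funext => p; rewrite /g /= !patchE /sw/=.
  congr (if _ then _ else _).
  by apply/idP/idP; rewrite !inE => -[].
have ig : (leb2 R).-integrable setT (EFin \o (g \o sw)).
  rewrite -gsw -restrict_EFin; apply/(integrable_mkcond _ msq).
  apply: (@integrable_square R _ M).
    exact: measurable_square_swap.
  by move=> p [p1 p2]; apply: fM; split.
rewrite Rintegral_mkcond gsw [RHS]Rintegral_mkcond.
congr fine.
have mEg : measurable_fun setT (EFin \o g) by exact/measurable_EFinP.
have := integral_pushforward msw mEg ig measurableT.
rewrite preimage_setT => <-; apply: eq_measure_integral => A mA _.
apply/esym; apply: product_measure_unique => // B C mB mC.
transitivity (leb2 R (C `*` B)).
  by congr (leb2 R _); apply/seteqP; split => p [].
by rewrite muleC; exact: product_measure1E.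
Qed.

Section cube_flux.
Variables (R : realType) (Om : set 'rV[R]_3) (x : 'rV[R]_3) (e : R).
Hypotheses (e0 : 0 < e) (oOm : open Om) (xeOm : cube x e `<=` Om).
Local Notation axis i := (delta_mx 0 i : 'rV[R]_3).

Let square01 (p : R * R) : square p -> 0 <= p.1 <= 1 /\ 0 <= p.2 <= 1.
Proof. by case; rewrite /= !in_itv. Qed.

Lemma measurable_fun_face (g : 'rV[R]_3 -> R) (c : R) (i : 'I_3) :
  {within Om, continuous g} -> `|c| <= e ->
  measurable_fun (@square R : set (measurableTypeR R * measurableTypeR R))
    (fun p => g (face_point x e c i p.1 p.2)).
Proof.
move=> cg ce.
pose q (p : measurableTypeR R * measurableTypeR R) :
    measurableTypeR R * measurableTypeR R * measurableTypeR R :=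
  let y := face_point x e c i p.1 p.2 in (y 0 0, y 0 1, y 0 2%:R).
have qE p : vec3 (q p) = face_point x e c i p.1 p.2.
  apply/rowP => -[[|[|[|//]]] j3]; rewrite mxE/=.
  - by congr (face_point _ _ _ _ _ _ _ _); apply/val_inj.
  - by congr (face_point _ _ _ _ _ _ _ _); apply/val_inj.
  - by congr (face_point _ _ _ _ _ _ _ _); apply/val_inj.
have mcoord j : measurable_fun setT
    (fun p : measurableTypeR R * measurableTypeR R =>
      face_point x e c i p.1 p.2 0 j : measurableTypeR R).
  under eq_fun do rewrite mxE.
  apply: measurable_funD => //; case: (j == i) => //.
  apply: measurable_funM => //; apply: measurable_funB => //.
  apply: measurable_funM => //.
  by case: (j == i + 1); [exact: measurable_fst|exact: measurable_snd].
have mq : measurable_fun setT q.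
  by apply: measurable_fun_pair; [apply: measurable_fun_pair|]; exact: mcoord.
have -> : (fun p => g (face_point x e c i p.1 p.2)) = (g \o @vec3 R) \o q.
  by apply/funext => p /=; rewrite qE.
have mcube := compact_borel3 (@compact_cube R x e).
apply: (measurable_comp (F := @vec3 R @^-1` cube x e)) => //.
- move=> _ [p /square01[p1 p2] <-] /=; rewrite qE.
  exact: face_point_cube.
- exact: measurable_fun_vec3 cg mcube xeOm.
- exact: measurable_funTS.
Qed.

Lemma is_derive_face_point (g : 'rV[R]_3 -> R) (c : R) (i : 'I_3) (a b : R) :
  derivable g (face_point x e c i a b) (axis i) ->
  is_derive c 1 (fun c => g (face_point x e c i a b))
    ('D_(axis i) g (face_point x e c i a b)).
Proof.
have E : (fun h : R => h^-1 *: ((g (face_point x e (h *: 1 + c) i a b))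
      - g (face_point x e c i a b))) =
    (fun h : R => h^-1 *: ((g (h *: axis i + face_point x e c i a b))
      - g (face_point x e c i a b))).
  apply/funext => h; congr (_ *: (g _ - _)); apply/rowP => j.
  rewrite !mxE eqxx /=; case: (j == i).
    by rewrite [h *: 1]mulr1 mulr1 addrCA.
  by rewrite mulr0 add0r.
move=> dg; apply: DeriveDef; first by rewrite /derivable E.
by rewrite /derive E.
Qed.

(** The mean value theorem along the [i]-th axis, on the segment joining two
    opposite points of the boundary. *)
Lemma face_difference_near (g : 'rV[R]_3 -> R) (i : 'I_3) (d eta a b : R) :
  (forall y, Om y -> derivable g y (axis i)) ->
  (forall y, cube x e y -> `|'D_(axis i) g y - d| <= eta) ->
  0 <= a <= 1 -> 0 <= b <= 1 ->
  `|g (face_point x e e i a b) - g (face_point x e (- e) i a b) - 2 * e * d| <=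
  2 * e * eta.
Proof.
move=> dg gd a01 b01.
have inc c : c \in `[- e, e] -> cube x e (face_point x e c i a b).
  by rewrite in_itv/= => ce; apply: face_point_cube => //; rewrite ler_norml.
have der c : c \in `[- e, e] -> is_derive c 1
    (fun c => g (face_point x e c i a b))
    ('D_(axis i) g (face_point x e c i a b)).
  by move=> /inc/xeOm/dg; exact: is_derive_face_point.
have lee : - e <= e by have := e0; lra.
pose phi c := g (face_point x e c i a b).
pose dphi c := 'D_(axis i) g (face_point x e c i a b).
have [c ce phiE] : exists2 c, c \in `[- e, e] & phi e - phi (- e) =
    dphi c * (e - (- e)).
  have M := @MVT_segment R phi dphi (- e) e lee.
  have D0 c : c \in `]- e, e[ -> is_derive c 1 phi (dphi c).
    by move=> ce; apply: der; exact: subset_itv_oo_cc ce.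
  have cphi : {within `[- e, e], continuous phi}.
    by apply: derivable_within_continuous => c /der[].
  exact: M D0 cphi.
rewrite -/(phi e) -/(phi (- e)) phiE.
rewrite opprK -mulr2n -(mulr_natl e) [_ * (2 * e)]mulrC -mulrBr normrM.
rewrite gtr0_norm ?mulr_gt0// ler_pM2l ?mulr_gt0//.
exact: gd (inc _ ce).
Qed.

Variable g : 'I_3 -> 'rV[R]_3 -> R.
Hypothesis cg : forall i, {within Om, continuous (g i)}.

Let face_bounded i : exists M, forall c p, `|c| <= e -> square p ->
  `|g i (face_point x e c i p.1 p.2)| <= M.
Proof.
have [M gM] := continuous_on_compact_bounded (@cg i) (@compact_cube R x e) xeOm.
exists M => c p ce /square01[p1 p2]; apply: gM.
exact: face_point_cube.
Qed.

Let integrable_face i c : `|c| <= e ->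
  (leb2 R).-integrable (@square R)
    (EFin \o (fun p => g i (face_point x e c i p.1 p.2))).
Proof.
move=> ce; have [M gM] := face_bounded i.
apply: (@integrable_square R _ M); last by move=> p; exact: gM.
exact: measurable_fun_face.
Qed.

Lemma cube_fluxE :
  surface_integral (cube_face x e) (fun y n => \sum_(i < 3) n 0 i * g i y) =
  \sum_(i < 3) (2 * e) ^+ 2 * \int[leb2 R]_(p in @square R)
    (g i (face_point x e e i p.1 p.2) - g i (face_point x e (- e) i p.1 p.2)).
Proof.
have pe : `|e| <= e by rewrite gtr0_norm.
have ne : `|- e| <= e by rewrite normrN.
have normal i (s : R) y : \sum_(j < 3) (s *: axis i) 0 j * g j y = s * g i y.
  rewrite (bigD1 i)//= big1 ?addr0 ?mxE ?eqxx ?mulr1// => j ji.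
  by rewrite !mxE eqxx (negPf ji) mulr0 mul0r.
rewrite /surface_integral big_split_ord/= -big_split/=; apply: eq_bigr => i _.
rewrite /cube_face (unsplitK (inl i)) (unsplitK (inr i)).
transitivity ((2 * e) ^+ 2 *
    (\int[leb2 R]_(p in @square R) g i (face_point x e e i p.1 p.2) -
     \int[leb2 R]_(p in @square R) g i (face_point x e (- e) i p.1 p.2))).
  rewrite mulrBr; congr (_ + _).
    rewrite -(RintegralZl _ (@measurable_square R) (integrable_face i pe)).
    apply: eq_Rintegral => p _.
    rewrite unit_normal_upper_face// enorm_area_upper_face// upper_faceE.
    by rewrite -[axis i]scale1r normal mul1r mulrC.
  have [M gM] := face_bounded i.
  rewrite -(@Rintegral_square_swap R
    (fun p => g i (face_point x e (- e) i p.1 p.2)) M); first last.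
  - by move=> p /gM; exact.
  - exact: measurable_fun_face.
  have isw : (leb2 R).-integrable (@square R)
      (EFin \o (fun p => g i (face_point x e (- e) i p.2 p.1))).
    apply: (@integrable_square R _ M); last first.
      by move=> p [p1 p2]; exact: (gM (- e) (p.2, p.1) ne (conj p2 p1)).
    apply: (@measurable_square_swap R
      (fun p => g i (face_point x e (- e) i p.1 p.2))).
    exact: measurable_fun_face.
  rewrite -mulNr -(RintegralZl _ (@measurable_square R) isw).
  apply: eq_Rintegral => p _.
  rewrite unit_normal_lower_face// enorm_area_lower_face// lower_faceE.
  by rewrite -[- axis i]scaleN1r normal mulN1r mulNr mulrC mulNr.
rewrite -RintegralB//; first exact: measurable_square.
  exact: integrable_face.
exact: integrable_face.
Qed.

(** The divergence theorem on a small cube, in approximate form: the flux is the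
    volume times a value close to the divergence at the centre.  Each of the
    three axes contributes an error [eta]. *)
Lemma cube_flux_near (d : 'I_3 -> R) (eta : R) :
  (forall i y, Om y -> derivable (g i) y (axis i)) ->
  (forall i y, cube x e y -> `|'D_(axis i) (g i) y - d i| <= eta) ->
  `|surface_integral (cube_face x e) (fun y n => \sum_(i < 3) n 0 i * g i y) -
    (\sum_(i < 3) d i) * (2 * e) ^+ 3| <= 3 * eta * (2 * e) ^+ 3.
Proof.
move=> dg gd; rewrite cube_fluxE big_distrl/= -sumrB.
have -> : 3 * eta * (2 * e) ^+ 3 = \sum_(i < 3) (2 * e) ^+ 2 * (2 * e * eta).
  by rewrite big_const_ord iter_addr_0 -mulr_natl; ring.
apply: le_trans (ler_norm_sum _ _ _) _; apply: ler_sum => i _.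
have -> : d i * (2 * e) ^+ 3 = (2 * e) ^+ 2 * (2 * e * d i) by ring.
rewrite -mulrBr normrM (ger0_norm (sqr_ge0 _)) ler_wpM2l ?sqr_ge0//.
have pe : `|e| <= e by rewrite gtr0_norm.
have ne : `|- e| <= e by rewrite normrN.
have := @Rintegral_near _ _ R (leb2 R) (@square R)
  (fun p => g i (face_point x e e i p.1 p.2) -
    g i (face_point x e (- e) i p.1 p.2)) (2 * e * d i) (2 * e * eta).
rewrite [X in fine X]leb2_square /= !mulr1; apply.
- exact: measurable_square.
- by rewrite [X in (X < _)%E]leb2_square ltry.
- by apply: measurable_funB; exact: measurable_fun_face.
- by move=> p /square01[p1 p2]; apply: face_difference_near => // y;
    [exact: dg|exact: gd].
Qed.

End cube_flux.

(** * The rate of change of momentum *)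

(** A mean value inequality: a derivative within [eta] of [a] on an interval
    makes all increments there proportional to [a] up to [eta]. *)
Lemma increment_near (R : realType) (phi dphi : R -> R) (t r a eta s : R) :
  (forall c, `|c - t| <= r -> is_derive c 1 phi (dphi c)) ->
  (forall c, `|c - t| <= r -> `|dphi c - a| <= eta) -> `|s - t| <= r ->
  `|phi s - phi t - (s - t) * a| <= `|s - t| * eta.
Proof.
move=> der da sr.
have incr p q : p <= q -> `|p - t| <= r -> `|q - t| <= r ->
    `|phi q - phi p - (q - p) * a| <= (q - p) * eta.
  move=> pq pr qr.
  have inr c : c \in `[p, q] -> `|c - t| <= r.
    rewrite in_itv/= => /andP[pc cq]; move: pr qr; rewrite !ler_distl; lra.
  have D0 c : c \in `]p, q[ -> is_derive c 1 phi (dphi c).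
    by move=> /subset_itv_oo_cc/inr; exact: der.
  have cphi : {within `[p, q], continuous phi}.
    by apply: derivable_within_continuous => c /inr/der[].
  have [c /inr cr ->] := @MVT_segment R phi dphi p q pq D0 cphi.
  rewrite [dphi c * _]mulrC -mulrBr normrM ger0_norm ?subr_ge0//.
  by rewrite ler_wpM2l ?subr_ge0// da.
have r0 : 0 <= r by exact: le_trans sr.
have tr : `|t - t| <= r by rewrite subrr normr0.
have [ts|st] := leP t s.
  by rewrite [X in _ <= X * _]ger0_norm ?subr_ge0//; exact: incr.
rewrite [X in _ <= X * _]distrC.
rewrite [X in _ <= X * _]ger0_norm ?subr_ge0 ?(ltW st)//.
have -> : phi s - phi t - (s - t) * a = - (phi t - phi s - (t - s) * a) by ring.
by rewrite normrN; apply: incr => //; exact: ltW.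
Qed.

(** Bounds on the difference quotients pass to the derivative. *)
Lemma derive_near (R : realType) (F : R -> R) (t L c k : R) :
  is_derive t 1 F L ->
  (\forall s \near t, `|F s - F t - (s - t) * c| <= `|s - t| * k) ->
  `|L - c| <= k.
Proof.
move=> [dF <-] Fc.
have lim : `|h^-1 *: (F (h *: 1 + t) - F t) - c| @[h --> 0^']
    --> `|'D_1 F t - c|.
  by apply: cvg_norm; apply: cvgB; [exact: dF|exact: cvg_cst].
apply: (cvgr_to_le lim).
have Fh : \forall h \near 0^', `|F (h *: 1 + t) - F t - h * c| <= `|h| * k.
  apply: nbhs_dnbhs.
  have hc : (h + t) @[h --> 0] --> t.
    rewrite -[X in _ --> X]add0r.
    by apply: cvgD; [exact: cvg_id|exact: cvg_cst].
  have Fc0 : \forall h \near 0, `|F (h + t) - F t - (h + t - t) * c| <=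
      `|h + t - t| * k by exact: hc _ Fc.
  by apply: filterS Fc0 => h; rewrite addrK [h *: 1]mulr1.
near=> h.
have h0 : h != 0 by near: h; exact: nbhs_dnbhs_neq.
have : `|F (h *: 1 + t) - F t - h * c| <= `|h| * k by near: h.
set D := F (h *: 1 + t) - F t; rewrite -[h^-1 *: D]/(h^-1 * D).
have -> : D - h * c = h * (h^-1 * D - c) by rewrite mulrBr mulVKf.
by rewrite normrM ler_pM2l ?normr_gt0.
Unshelve. all: by end_near. Qed.

Section momentum_rate.
Variables (R : realType) (J : set R) (B0 : set 'rV[R]_3).
Variable u : R -> 'rV[R]_3 -> 'rV[R]_3.
Hypotheses (oJ : open J) (regu : regular_motion J B0 u).

Lemma is_derive_coord (f : R -> 'rV[R]_3) (t : R) (j : 'I_3) :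
  derivable f t 1 -> is_derive t 1 (fun s => f s 0 j) (derive1 f t 0 j).
Proof.
move=> df; rewrite derive1E derive_mx// mxE.
by apply: DeriveDef => //; move/derivable_mxP : df.
Qed.

(** For times near [t], following the motion from [x] always designates the same
    particle. *)
Lemma accelerationE t x : J t -> configuration B0 u t x ->
  acceleration B0 u t x = derive1 (derive1 (u ^~ (particle B0 u t x))) t.
Proof.
move=> Jt tx; rewrite /acceleration ![in LHS]derive1E [RHS]derive1E.
apply: near_eq_derive; have : nbhs t J by exact: open_nbhs_nbhs.
apply: filterS => s Js; rewrite /velocity (particleK regu)//.
exact: (particle_ref regu Jt tx).
Qed.

Lemma continuous_velocity_coord t j : J t ->
  {within B0, continuous (fun X => derive1 (u ^~ X) t 0 j)}.
Proof.
move=> Jt; have [oB0 _ _ [_ cv _]] := regu.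
have := continuous_time_slice oJ regu cv Jt.
rewrite !continuous_open_subspace// => {}cv X B0X.
apply: (@continuous_comp _ _ _ (fun X => derive1 (u ^~ X) t)
  (fun v : 'rV[R]_3 => v 0 j)); first exact: cv.
exact: coord_continuous.
Qed.

Variable rho : R -> 'rV[R]_3 -> R.
Hypothesis rho0 : forall t x, J t -> configuration B0 u t x -> 0 <= rho t x.
Hypothesis crho :
  forall t, J t -> {within configuration B0 u t, continuous (rho t)}.
Hypothesis mass : mass_conservation J B0 u rho.

(** By [mass_transport] the momentum at any time is an integral over the place [K]
    of the part at time [t] with the density at that time, so its increments are
    integrals of velocity increments of fixed particles. *)
Lemma momentum_rate_near (P : set 'rV[R]_3) (j : 'I_3) (t r a eta L : R) :
  compact P -> P `<=` B0 -> 0 < r -> (forall s, `|s - t| <= r -> J s) ->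
  (forall s X, `|s - t| <= r -> P X ->
    `|derive1 (derive1 (u ^~ X)) s 0 j - a| <= eta) ->
  is_derive t 1 (fun s => volume_integral (motion u s @` P)
    (fun x => rho s x * velocity B0 u s x 0 j)) L ->
  `|L - a * volume_integral (motion u t @` P) (rho t)| <=
  eta * volume_integral (motion u t @` P) (rho t).
Proof.
move=> cP PB0 r0 rJ acc dF.
have Jt : J t by apply: rJ; rewrite subrr normr0 ltW.
have oBt : open (configuration B0 u t) by have [_ /(_ t Jt)[]] := regu.
set K := motion u t @` P; set m := volume_integral K (rho t).
have cK : compact K := compact_motion oJ regu cP PB0 Jt.
have KBt : K `<=` configuration B0 u t by exact: image_subset.
pose v s X := derive1 (u ^~ X) s 0 j.
apply: (derive_near dF).
have : nbhs t [set s | `|s - t| <= r].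
  by apply/nbhs_ballP; exists r => //= s; rewrite /ball/= distrC => /ltW.
apply: filterS => s /= sr; have Js := rJ s sr.
have FE q : J q -> volume_integral (motion u q @` P)
    (fun x => rho q x * velocity B0 u q x 0 j) =
    volume_integral K (fun x => rho t x * v q (particle B0 u t x)).
  move=> Jq; rewrite -(mass_transport oJ regu rho0 crho mass cP PB0 _ Jq Jt)//.
  exact: continuous_velocity_coord.
rewrite (FE s Js) (FE t Jt).
have mK := compact_borel3 cK.
have irho := integrable_vec3 oBt (crho Jt) cK KBt.
have cvq q : J q ->
    {within configuration B0 u t, continuous (v q \o particle B0 u t)}.
  move=> Jq; apply: (continuous_comp_particle regu Jt).
  exact: continuous_velocity_coord.
have mv q : J q -> measurable_fun (@vec3 R @^-1` K : set (measurableTypeR R *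
    measurableTypeR R * measurableTypeR R))
    ((v q \o particle B0 u t) \o @vec3 R).
  by move=> Jq; exact: measurable_fun_vec3 oBt (cvq q Jq) mK KBt.
have iv q : J q -> (leb3 R).-integrable (@vec3 R @^-1` K)
    (EFin \o (fun p => rho t (vec3 p) * v q (particle B0 u t (vec3 p)))).
  move=> Jq; have [M vM] := continuous_on_compact_bounded (cvq q Jq) cK KBt.
  apply: (integrable_weighted (M := M) mK irho (mv q Jq)).
  by move=> p; exact: vM.
rewrite /volume_integral -RintegralB//; [|exact: iv|exact: iv].
under eq_Rintegral do rewrite -mulrBr.
rewrite mulrA.
rewrite [leRHS]mulrA.
apply: (@Rintegral_weighted_near _ _ R (leb3 R) (@vec3 R @^-1` K)
  (rho t \o @vec3 R) (fun p => v s (particle B0 u t (vec3 p)) -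
    v t (particle B0 u t (vec3 p))) ((s - t) * a) (`|s - t| * eta)) => //.
- by move=> p /KBt; exact: rho0.
- by apply: measurable_funB; exact: mv.
- move=> p [X PX <-]; rewrite (particleK regu Jt (PB0 X PX)).
  have [_ _ du _] := regu.
  apply: (@increment_near R (fun s => v s X)
    (fun s => derive1 (derive1 (u ^~ X)) s 0 j) t r) => // c cr.
    by apply: is_derive_coord; have [] := du c X (rJ c cr) (PB0 X PX).
  exact: acc.
Qed.

End momentum_rate.

(** * Localization *)

Lemma localize_balance (R : realType) (eta V rx a fb d m Ib S : R) :
  0 < eta <= 1 -> 0 < V -> 0 <= rx ->
  `|Ib + S - a * m| <= eta * m -> `|m - rx * V| <= eta * V ->
  `|Ib - fb * V| <= eta * V -> `|S - d * V| <= 3 * eta * V ->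
  `|rx * a - (fb + d)| <= eta * (`|a| + rx + 5).
Proof.
move=> /andP[eta0 eta1] V0 rx0 hL hm hb hS; rewrite -(ler_pM2r V0).
rewrite -[X in `|_| * X](gtr0_norm V0) -normrM.
have -> : (rx * a - (fb + d)) * V = - (Ib + S - a * m) - a * (m - rx * V) +
    (Ib - fb * V) + (S - d * V) by ring.
have ha : `|a * (m - rx * V)| <= `|a| * (eta * V).
  by rewrite normrM ler_wpM2l.
have mV : m <= (rx + 1) * V.
  have etaV : eta * V <= V by rewrite ger_pMl.
  by move: hm; rewrite ler_norml => /andP[_]; lra.
have etam : eta * m <= eta * ((rx + 1) * V) by rewrite ler_wpM2l// ltW.
apply: le_trans (ler_normD _ _) _; apply: le_trans (lerD (ler_normD _ _) hS) _.
apply: le_trans (lerD (lerD (ler_normB _ _) hb) (lexx _)) _.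
rewrite normrN; move: ha hL etam; lra.
Qed.

Theorem mainTheorem2 (R : realType) (alpha : R) (J : set R)
    (B0 : set 'rV[R]_3) (u : R -> 'rV[R]_3 -> 'rV[R]_3)
    (rho : R -> 'rV[R]_3 -> R) (b : R -> 'rV[R]_3 -> 'rV[R]_3)
    (sigma : R -> 'rV[R]_3 -> 'M[R]_3) (lA lB : R -> 'rV[R]_3 -> 'rV[R]_3) :
  0 < alpha < 1 ->
  open J -> is_interval J -> regular_motion J B0 u ->
  (forall t, J t -> [/\
    forall x, configuration B0 u t x -> 0 <= rho t x,
    {within configuration B0 u t, continuous (rho t)},
    {within configuration B0 u t, continuous (b t)} &
    {within configuration B0 u t, continuous (sigma t)}]) ->
  (forall t x i, J t -> configuration B0 u t x -> [/\
    0 < lA t x 0 i, 0 < lB t x 0 i &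
    forall s, x 0 i - lB t x 0 i <= s <= x 0 i + lA t x 0 i ->
      configuration B0 u t (set_coord x i s)]) ->
  (forall t i j, J t -> [/\
    {within configuration B0 u t, continuous
      (riesz_I alpha (lA t) (lB t) i (fun y => sigma t y i j))},
    forall x, configuration B0 u t x ->
      derivable (riesz_I alpha (lA t) (lB t) i (fun y => sigma t y i j))
        x (delta_mx 0 i) &
    {within configuration B0 u t, continuous
      (riesz_D alpha (lA t) (lB t) i (fun y => sigma t y i j))}]) ->
  mass_conservation J B0 u rho ->
  momentum_balance J B0 u rho b
    (fun t => nonlocal_traction alpha (lA t) (lB t) (sigma t)) ->
  forall t x (j : 'I_3), J t -> configuration B0 u t x ->
    rho t x * acceleration B0 u t x 0 j =
    rho t x * b t x 0 j +
    \sum_(i < 3) riesz_D alpha (lA t) (lB t) i (fun y => sigma t y i j) x.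
Proof.
move=> _ oJ _ regu fields _ stress mass momentum t x j Jt tx.
have [oB0 /(_ t Jt)[_ oOm cpart] _ [_ _ ca]] := regu.
have rho0 s y : J s -> configuration B0 u s y -> 0 <= rho s y.
  by move=> Js; have [+ _ _ _] := fields s Js; exact.
have crho s : J s -> {within configuration B0 u s, continuous (rho s)}.
  by move=> Js; have [] := fields s Js.
have [_ _ cb _] := fields t Jt.
set Om := configuration B0 u t in tx oOm cpart cb *.
set a := acceleration B0 u t x 0 j.
pose g i := riesz_I alpha (lA t) (lB t) i (fun y => sigma t y i j).
pose d i := riesz_D alpha (lA t) (lB t) i (fun y => sigma t y i j) x.
have cg i : {within Om, continuous (g i)} by have [] := stress t i j Jt.
have dg i y : Om y -> derivable (g i) y (delta_mx 0 i).
  by have [_ + _] := stress t i j Jt; exact.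
have at_x (f : 'rV[R]_3 -> R) (eta : R) :
    {within Om, continuous f} -> 0 < eta ->
    \forall y \near x, `|f y - f x| <= eta.
  rewrite continuous_open_subspace// => cf eta0.
  have := cf x (mem_set tx) => /cvgrPdist_le/(_ _ eta0).
  by apply: filterS => y; rewrite distrC.
have crhob : {within Om, continuous (fun y => rho t y * b t y 0 j)}.
  rewrite continuous_open_subspace// => y Omy.
  have := crho t Jt; rewrite continuous_open_subspace// => /(_ y Omy) cr.
  move: cb; rewrite continuous_open_subspace// => /(_ y Omy) cby.
  apply: (@continuousM _ _ (rho t)) => //.
  apply: (@continuous_comp _ _ _ (b t) (fun v : 'rV[R]_3 => v 0 j)) => //.
  exact: coord_continuous.
set X0 := particle B0 u t x.
have B0X0 : B0 X0 by exact: (particle_ref regu Jt tx).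
have near_eta (eta : R) : 0 < eta -> eta <= 1 ->
    `|rho t x * a - (rho t x * b t x 0 j + \sum_(i < 3) d i)| <=
    eta * (`|a| + rho t x + 5).
  move=> eta0 eta1.
  (* One neighbourhood of times [A1] serves all particles in [A2]. *)
  have [[A1 A2] [/= tA1 X0A2] accA] : nbhs (t, X0) (fun p =>
      `|derive1 (derive1 (u ^~ p.2)) p.1 0 j - a| <= eta).
    move: ca; rewrite continuous_open_subspace; last exact: open_setX.
    move=> /(_ (t, X0)); rewrite inE => /(_ (conj Jt B0X0)) ctX.
    have /cvgrPdist_le/(_ eta eta0) cj :
        derive1 (derive1 (u ^~ p.2)) p.1 0 j @[p --> (t, X0)] --> a.
      rewrite /a (accelerationE oJ regu Jt tx).
      exact: continuous_comp ctX (@coord_continuous R 1 3 0 j _).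
    by near=> p; rewrite distrC; near: p.
  have [r r0 rA1] : exists2 r : R, 0 < r &
      forall s, `|s - t| <= r -> A1 s /\ J s.
    have : nbhs t (A1 `&` J) by apply: filterI => //; exact: open_nbhs_nbhs.
    move=> /nbhs_ballP[r /= r0 tr]; exists (r / 2); first by rewrite divr_gt0.
    move=> s sr; apply: tr; rewrite /ball/= distrC (le_lt_trans sr)//.
    by rewrite ltr_pdivrMr// ltr_pMr// ltr1n.
  have xA2 : \forall y \near x, A2 (particle B0 u t y).
    move: cpart; rewrite continuous_open_subspace// => /(_ x (mem_set tx)).
    by apply.
  have xOm : nbhs x Om by exact: open_nbhs_nbhs.
  have := at_x _ _ (crho t Jt) eta0; have := at_x _ _ crhob eta0.
  have dnear : \forall y \near x,
      forall i, `|'D_(delta_mx 0 i) (g i) y - d i| <= eta.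
    apply: (@filter_forall _ _
      (fun i y => `|'D_(delta_mx 0 i) (g i) y - d i| <= eta)
      (nbhs x) (nbhs_filter x)) => i.
    have [_ _ cD] := stress t i j Jt.
    exact: at_x cD eta0.
  move=> rhobnear rhonear.
  have [e [e0 xeA]] : exists e : R, 0 < e /\ cube x e `<=` [set y |
      [/\ Om y, A2 (particle B0 u t y), `|rho t y - rho t x| <= eta,
        `|rho t y * b t y 0 j - rho t x * b t x 0 j| <= eta &
        forall i, `|'D_(delta_mx 0 i) (g i) y - d i| <= eta]].
    have /cube_nbhs near0 : nbhs x [set y |
      [/\ Om y, A2 (particle B0 u t y), `|rho t y - rho t x| <= eta,
        `|rho t y * b t y 0 j - rho t x * b t x 0 j| <= eta &
        forall i, `|'D_(delta_mx 0 i) (g i) y - d i| <= eta]].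
      by near=> y; split; near: y.
    near (0 : R)^'+ => e; exists e; split; first by [].
    by near: e.
  have xeOm : cube x e `<=` Om by move=> y /xeA[].
  pose P := particle B0 u t @` cube x e.
  have cP : compact P := compact_particle regu (@compact_cube R x e) xeOm Jt.
  have PB0 : P `<=` B0.
    by move=> _ [y /xeOm ye <-]; exact: (particle_ref regu Jt ye).
  have PE : motion u t @` P = cube x e.
    apply/seteqP; split=> [_ [_ [y ye <-] <-]|y ye].
      by rewrite motion_particle//; exact: xeOm.
    exists (particle B0 u t y); first by exists y.
    by rewrite motion_particle//; exact: xeOm.
  have mc := compact_borel3 (@compact_cube R x e).
  have V0 : 0 < (2 * e) ^+ 3 by rewrite exprn_gt0// mulr_gt0.
  have Vlt : (leb3 R (@vec3 R @^-1` cube x e) < +oo)%E.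
    exact: leb3_compact (@compact_cube R x e).
  have leb : fine (leb3 R (@vec3 R @^-1` cube x e)) = (2 * e) ^+ 3.
    by rewrite [X in fine X](leb3_cube x (ltW e0)).
  have average (f : 'rV[R]_3 -> R) c : {within Om, continuous f} ->
      (forall y, cube x e y -> `|f y - c| <= eta) ->
      `|volume_integral (cube x e) f - c * (2 * e) ^+ 3| <= eta * (2 * e) ^+ 3.
    move=> cf fc; rewrite -leb; apply: Rintegral_near => //.
      exact: measurable_fun_vec3 oOm cf mc xeOm.
    by move=> p; exact: fc.
  have patch := piecewise_C1_cube x e0.
  rewrite -PE in patch.
  have tractionE : (fun y n =>
      nonlocal_traction alpha (lA t) (lB t) (sigma t) y n 0 j) =
      (fun y n => \sum_(i < 3) n 0 i * g i y).
    by apply/funext => y; apply/funext => n; rewrite mxE.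
  have rJ s : `|s - t| <= r -> J s by move=> /rA1[].
  have accP s X : `|s - t| <= r -> P X ->
      `|derive1 (derive1 (u ^~ X)) s 0 j - a| <= eta.
    move=> /rA1[A1s _] [y /xeA[_ A2y _ _ _] <-].
    by apply: (accA (s, particle B0 u t y)).
  have dF := momentum P t _ _ j (compact_part cP PB0) Jt patch.
  have := momentum_rate_near oJ regu rho0 crho mass cP PB0 r0 rJ accP dF.
  rewrite tractionE PE => rate.
  apply: (@localize_balance R eta ((2 * e) ^+ 3) _ _ _ _
    (volume_integral (cube x e) (rho t))
    (volume_integral (cube x e) (fun y => rho t y * b t y 0 j))
    (surface_integral (cube_face x e)
      (fun y n => \sum_(i < 3) n 0 i * g i y))) => //.
  - by rewrite eta0.
  - exact: rho0.
  - by apply: average => [|y /xeA[]]; first exact: crho.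
  - by apply: average => // y /xeA[].
  - apply: (cube_flux_near e0 oOm xeOm cg dg).
    by move=> i y /xeA[].
(* [eta := min 1 (k / C)] makes the error at most [k]. *)
apply/eqP; rewrite -subr_eq0 -normr_le0; apply/ler_addgt0Pr => k k0.
rewrite add0r; set C := `|a| + rho t x + 5.
have C0 : 0 < C by rewrite ltr_wpDl// addr_ge0//; exact: rho0.
have eta0 : 0 < Num.min 1 (k / C) by rewrite lt_min ltr01 divr_gt0.
apply: le_trans (near_eta _ eta0 _) _; first by rewrite ge_min lexx.
by rewrite -ler_pdivlMr// ge_min lexx orbT.
Unshelve. all: by end_near. Qed.
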